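(* Let $A,B,C\subseteq F$, and let $M=\max(|A|,|BC|)$. Suppose that $|A||B||BC|\ll p^2$. Then $$\mathsf E(A,C)\ll (|A||BC|)^{3/2}|B|^{-1/2}+M|A||BC||B|^{-1}.$$ In particular, for any $A\subseteq F$ with $|A|<p^{5/8}$ the following holds: $$\max\{|A\pm A|,|AA|\}\gg |A|^{1+\frac15},$$ and $$\max\{|A\pm A|,|A:A|\}\gg |A|^{1+\frac15}.$$
   Context: $F=\mathbb F_q$ is a field of positive odd characteristic $p$, where $q$ is a power of the prime $p$. $|\cdot|$ denotes the cardinality of a finite set. For $X,Y\subseteq F$: $X\pm Y=\{x\pm y:x\in X,\,y\in Y\}$, $XY=\{xy:x\in X,\,y\in Y\}$, and $A:A=\{a/b:a,b\in A,\,b\neq0\}$ is the ratio set. The additive energy is $\mathsf E(A,C)=|\{(a_1,a_2,c_1,c_2)\in A\times A\times C\times C:\ a_1+c_1=a_2+c_2\}|$. The symbols $\ll$ and $\gg$ suppress absolute constants in inequalities.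
   Formalization: The energy bound is stated only for B nonempty, B ≠ {0} and C ≠ {0}: for empty B the right side is undefined, and it fails for A=B={0}, C=F and for A=C={0}, B=F_p with p large. *)

(* Defs.v *)
From mathcomp Require Import all_boot all_order all_algebra.
From mathcomp Require Import reals exp.

Set Implicit Arguments.
Unset Strict Implicit.
Unset Printing Implicit Defensive.

Import Order.TTheory GRing.Theory Num.Theory.

Local Open Scope ring_scope.

Section SetOperations.
Variable F : finFieldType.
Implicit Types X Y : {set F}.

Definition sumset X Y : {set F} := [set x + y | x in X, y in Y].

Definition diffset X Y : {set F} := [set x - y | x in X, y in Y].

Definition prodset X Y : {set F} := [set x * y | x in X, y in Y].

Definition ratioset X : {set F} := [set x / y | x in X, y in X & y != 0].

Definition additive_energy X Y : nat :=
  #|[set t : F * F * F * F | let: (x1, x2, y1, y2) := t in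
      [&& x1 \in X, x2 \in X, y1 \in Y, y2 \in Y & x1 + y1 == x2 + y2]]|.

End SetOperations.

(* Main.v *)
(** If [x1 + y1 = x2 + y2] with [x1, x2 \in A], [y1, y2 \in C] and [b1, b2] are nonzero
    elements of [B], then [t = (x1, b1^-1, b2 y2)] and [t' = (x2, b2^-1, b1 y1)] lie in
    [A * B^-1 * BC] and satisfy [t.1 + t.2 t'.3 = t'.1 + t'.2 t.3], which says that the points
    [(1 : t)] and [(1 : t')] of projective space are orthogonal for a symplectic form.  The
    energy bound follows from a bound for the number of such pairs in a set [X] of [N] points,
    at most [k] of them on a line: there are [O(N^(3/2) + k N)] of them if [N = O(p^2)].

    After a generic symplectic transformation over [F(T)] the third coordinates [s_i] are
    distinct.  With [f_i(x) = a_i + b_i x], the pair [(i, j)] is counted iff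
    [f_i(s_j) = f_j(s_i)], that is, iff the lines [w = f_i(x), y = s_i] and
    [w = f_j(y), x = s_j] of three-space meet.  Suppose that there are too many such pairs.
    After pruning, some polynomial [P(x, y, w)] of degree [d << sqrt N] vanishes on a random
    sample of the lines of the first kind, hence on most lines of the second kind, hence on
    most lines of the first kind.  A line of the first kind on an irreducible component [Q] of
    [P] meets few lines of the second kind on [Q], unless the whole line consists of points
    where the section of [Q] by the plane [x = const] has an inflection.  The resultant of [Q]
    with the inflection polynomial bounds the number of such lines by [O((deg Q)^2)], unless
    [Q] divides this polynomial; and as [deg Q < p], a [Q] dividing the inflection polynomials of
    both directions is [w = c0 + c1 x + c2 y + c3 x y].  Lines on such a surface come from
    collinear points, so there are at most [k] of them. *)

Require Import Defs.
From HB Require Import structures.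
From mathcomp Require Import all_boot all_order all_algebra.
From mathcomp Require Import boolp ring lra zify.
From mathcomp Require Import reals exp.

Set Implicit Arguments.
Unset Strict Implicit.
Unset Printing Implicit Defensive.

Import Order.TTheory GRing.Theory Num.Theory.

Local Open Scope ring_scope.

(** * Gauss's lemma and unique factorization *)

Section Factorial.
Variable R : idomainType.
Implicit Types a b c q : R.

Definition divides a b := exists c, b = a * c.

Definition prime_elt q :=
  [/\ q != 0, q \isn't a GRing.unit
    & forall a b, divides q (a * b) -> divides q a \/ divides q b].

(** Asking for prime rather than irreducible factors makes uniqueness automatic. *)
Definition factorial_ring := forall a, a != 0 ->
  exists u, exists l : seq R,
    [/\ u \is a GRing.unit, {in l, forall q, prime_elt q} & a = u * \prod_(q <- l) q].

Lemma dividesMl a b c : divides a b -> divides a (c * b).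
Proof. by case=> d ->; exists (c * d); rewrite mulrCA. Qed.

Lemma dividesMr a b c : divides a b -> divides a (b * c).
Proof. by rewrite mulrC; apply: dividesMl. Qed.

Lemma dividesD a b c : divides a b -> divides a c -> divides a (b + c).
Proof. by case=> x -> [y ->]; exists (x + y); rewrite mulrDr. Qed.

Lemma dividesN a b : divides a b -> divides a (- b).
Proof. by case=> x ->; exists (- x); rewrite mulrN. Qed.

Lemma prime_dvd_prod q (l : seq R) : prime_elt q ->
  divides q (\prod_(r <- l) r) -> exists2 r, r \in l & divides q r.
Proof.
move=> [q0 qU qP]; elim: l => [|r l IH].
  rewrite big_nil => -[c cE]; case/negP: qU.
  by apply/unitrPr; exists c.
rewrite big_cons => /qP [H|/IH [r' r'l H]].
  by exists r => //; rewrite mem_head.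
by exists r' => //; rewrite inE r'l orbT.
Qed.

Lemma prime_dvd_unit q c : prime_elt q -> divides q c -> c \isn't a GRing.unit.
Proof.
move=> [q0 qU _] [d ->]; rewrite unitrM negb_and; by rewrite qU.
Qed.

End Factorial.

Section Gauss.
Variable R : idomainType.
Implicit Types (P Q A B : {poly R}) (q c : R).

Lemma coef_dividesC q P i : divides q%:P P -> divides q P`_i.
Proof. by case=> Q ->; exists Q`_i; rewrite coefCM. Qed.

(** Gauss's lemma, by induction on [size A + size B]: [q] divides the product of the leading
    coefficients, hence one of them, and that leading term can be subtracted. *)
Lemma prime_polyC q : prime_elt q -> prime_elt q%:P.
Proof.
move=> qpr; have [q0 qU qP] := qpr; split; first by rewrite polyC_eq0.
  by rewrite rmorph_unit_iff // || (rewrite poly_unitE coefC /= (negPf qU) andbF).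
move=> A B; have [n] := ubnP (size A + size B)%N; elim: n => // n IH in A B *.
move=> leAB qAB.
have [A0|An0] := eqVneq A 0; first by left; exists 0; rewrite mulr0 A0.
have [B0|Bn0] := eqVneq B 0; first by right; exists 0; rewrite mulr0 B0.
have cut P : P != 0 -> divides q (lead_coef P) ->
    exists2 P' : {poly R}, (size P' < size P)%N & divides q%:P (P - P').
  move=> Pn0 [c cE]; exists (P - q%:P * (c%:P * 'X^((size P).-1))); last first.
    by rewrite opprB addrC subrK; exists (c%:P * 'X^((size P).-1)).
  rewrite mulrA -polyCM -cE.
  rewrite -[ltnRHS]prednK ?size_poly_gt0 // ltnS; apply/leq_sizeP => j.
  rewrite leq_eqVlt => /orP[/eqP <-|h].
    by rewrite coefB coefCM coefXn eqxx mulr1 lead_coefE subrr.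
  rewrite coefB coefCM coefXn gtn_eqF // mulr0 subr0 nth_default //.
  by rewrite -[leqLHS]prednK ?size_poly_gt0.
have qlc : divides q (lead_coef A * lead_coef B).
  by rewrite -lead_coefM lead_coefE; apply: coef_dividesC.
have trans (P P' : {poly R}) : divides q%:P (P - P') -> divides q%:P P' -> divides q%:P P.
  by move=> h1 h2; rewrite -(subrK P' P); apply: dividesD.
case: (qP _ _ qlc) => [/(cut _ An0)|/(cut _ Bn0)] [P' ltP' dP'].
  have dvdPB : divides q%:P (P' * B).
    rewrite -[P' * B](subrK (A * B)) -mulrBl -opprB mulNr; apply: dividesD => //.
    exact/dividesN/dividesMr.
  have [||] := IH P' B _ dvdPB; [|by left; apply: trans dP' _|by right].
  by apply: leq_trans (_ : size A + size B <= n)%N => //; rewrite ltn_add2r.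
have dvdAP : divides q%:P (A * P').
  rewrite -[A * P'](subrK (A * B)) -mulrBr -opprB mulrN; apply: dividesD => //.
  exact/dividesN/dividesMl.
have [||] := IH A P' _ dvdAP; [|by left|by right; apply: trans dP' _].
by apply: leq_trans (_ : size A + size B <= n)%N => //; rewrite ltn_add2l.
Qed.

Hypothesis ufdR : factorial_ring R.

(** The prime factors of [c] are cancelled one at a time, since each divides [A] or [B] by
    [prime_polyC]. This brings factorizations over the fraction field back to [R]. *)
Lemma gauss_strip c P A B : c != 0 -> c%:P * P = A * B ->
  exists a b A' B', [/\ a != 0, b != 0, A = a%:P * A', B = b%:P * B' & P = A' * B'].
Proof.
move=> /ufdR [u [l [uU lP ->]]].
elim: l lP A B => [|q l IH] lP A B.
  rewrite big_nil mulr1 => E.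
  exists u, 1, (u^-1%:P * A), B; split; rewrite ?oner_eq0 ?polyC1 ?mul1r //.
  - by apply: contraTneq uU => ->; rewrite unitr0.
  - by rewrite mulrA -polyCM divrr // mul1r.
  by rewrite -mulrA -E mulrA -polyCM mulVr // mul1r.
have [q0 qU qP] : prime_elt q%:P by apply/prime_polyC/lP; rewrite mem_head.
rewrite polyC_eq0 in q0.
have lP' : {in l, forall q, prime_elt q} by move=> r rl; apply: lP; rewrite inE rl orbT.
rewrite big_cons mulrCA polyCM -mulrA => E.
have /qP [[A1 A1E]|[B1 B1E]] : divides q%:P (A * B) by exists ((u * \prod_(j <- l) j)%:P * P).
  have /(IH lP') [a [b [A' [B' [an0 bn0 AE BE PE]]]]] :
      (u * \prod_(j <- l) j)%:P * P = A1 * B.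
    by apply: (@mulfI _ q%:P); rewrite ?polyC_eq0 // E A1E mulrA.
  exists (q * a), b, A', B'; split; rewrite ?mulf_neq0 //.
  by rewrite A1E AE polyCM mulrA.
have /(IH lP') [a [b [A' [B' [an0 bn0 AE BE PE]]]]] :
    (u * \prod_(j <- l) j)%:P * P = A * B1.
  by apply: (@mulfI _ q%:P); rewrite ?polyC_eq0 // E B1E mulrCA.
exists a, (q * b), A', B'; split; rewrite ?mulf_neq0 //.
by rewrite B1E BE polyCM mulrA.
Qed.

Definition primitive_poly P := forall q, prime_elt q -> ~ divides q%:P P.

Lemma primitive_part P : P != 0 ->
  exists a P', [/\ a != 0, P = a%:P * P' & primitive_poly P'].
Proof.
move=> Pn0; have [u [l [uU lP lcE]]] : _ := @ufdR (lead_coef P) (etrans (congr1 negb (lead_coef_eq0 P)) Pn0).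
have [n] := ubnP (size l); elim: n => // n IH in u l P Pn0 uU lP lcE *.
move=> szl.
have [[q [qpr [P1 PE]]]|noq] := EM (exists q, prime_elt q /\ divides q%:P P); last first.
  exists 1, P; split; rewrite ?oner_eq0 ?mul1r // => q qpr qP.
  by apply: noq; exists q.
have [q0 qU qP] := qpr.
have P1n0 : P1 != 0 by apply: contraNneq Pn0 => P10; rewrite PE P10 mulr0.
have lc1 : lead_coef P = q * lead_coef P1 by rewrite PE lead_coefM lead_coefC.
have /qP [|/(prime_dvd_prod qpr) [r rl [c rE]]] : divides q (u * \prod_(j <- l) j).
- by rewrite -lcE lc1; exists (lead_coef P1).
- by move/(prime_dvd_unit qpr); rewrite uU.
(* Both [q] and [r = q * c] are prime, so they are associates, and [r] can be removed from the
   factors of the leading coefficient. *)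
have cU : c \is a GRing.unit.
  have [r0 rU rP] := lP _ rl.
  have : divides r (q * c) by rewrite -rE; exists 1; rewrite mulr1.
  case/rP => -[x xE].
    apply/unitrPr; exists x; apply: (mulfI q0).
    by rewrite mulr1 mulrA -rE -xE.
  case/negP: qU; apply/unitrPr; exists x.
  have cn0 : c != 0 by apply: contraNneq r0 => c0; rewrite rE c0 mulr0.
  by apply: (mulfI cn0); rewrite mulr1 mulrCA mulrA -rE -xE.
have [|x|||a [P' [an0 P'E P'p]]] := IH (u * c) (rem r l) P1 P1n0.
- by rewrite unitrM uU.
- by move=> /mem_rem /lP.
- apply: (mulfI q0); rewrite -lc1 lcE (perm_big _ (perm_to_rem rl)) big_cons /= rE.
  by rewrite !mulrA (mulrC u).
- by rewrite size_rem // prednK //; case: (l) rl.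
exists (q * a), P'; split; rewrite ?mulf_neq0 //.
by rewrite PE P'E polyCM mulrA.
Qed.

Lemma primitive_dvd_strip P c A : primitive_poly P -> P != 0 -> c != 0 ->
  divides P (c%:P * A) -> divides P A.
Proof.
move=> Pp Pn0 cn0 [r /(gauss_strip cn0) [a [b [P' [r' [an0 bn0 PE rE ->]]]]]].
have [u [l [uU lP aE]]] := ufdR an0.
case: l lP aE => [|q l] lP aE; last first.
  case: (Pp q); first by apply: lP; rewrite mem_head.
  by rewrite PE aE big_cons mulrCA polyCM -mulrA; exists ((u * \prod_(j <- l) j)%:P * P').
rewrite big_nil mulr1 in aE.
exists (u^-1%:P * r'); rewrite PE aE mulrACA -polyCM divrr // mul1r //.
Qed.

(** After clearing denominators the gcd of [P] and [A] becomes a factor of [P], so its degree is 0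
    or that of [P]. Hence [P] divides [A] or [B] up to a constant, which primitivity removes. *)
Lemma primitive_irreducible_prime P : primitive_poly P -> (1 < size P)%N ->
  (forall A B, P = A * B -> (size A < size P)%N -> (size B < size P)%N -> False) ->
  prime_elt P.
Proof.
move=> Pp szP irr.
have Pn0 : P != 0 by rewrite -size_poly_gt0 ltnW.
split => //; first by rewrite poly_unitE gtn_eqF.
move=> A B [r ABE].
pose g := gcdp P A.
have gn0 : g != 0 by rewrite gcdp_eq0 negb_and Pn0.
have : (P %| A) \/ coprimep P A.
  have /Pdiv.Idomain.dvdpP [[c r1] /= cn0 E] : g %| P by apply: dvdp_gcdl.
  rewrite -mul_polyC in E.
  have [a [b [r' [g' [an0 bn0 rE gE PE]]]]] := gauss_strip cn0 E.
  have r'n0 : r' != 0 by apply: contraNneq Pn0 => z; rewrite PE z mul0r.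
  have g'n0 : g' != 0 by apply: contraNneq Pn0 => z; rewrite PE z mulr0.
  have szg : size g = size g' by rewrite gE mul_polyC size_scale.
  have szE : size P = (size r' + size g').-1 by rewrite PE size_mul.
  have r0 : (0 < size r')%N by rewrite size_poly_gt0.
  have g0 : (0 < size g')%N by rewrite size_poly_gt0.
  have := irr _ _ PE.
  have [h1 _|h1] := ltnP (size g') 2.
    right; rewrite coprimep_def -/g szg eqn_leq g0 andbT //.
  have [h2 _|h2] := ltnP (size r') 2.
    left; have eqg : g %= P.
      rewrite -(dvdp_size_eqp (dvdp_gcdl P A)) -/g szg szE.
      by move: h2 r0; case: (size r') => [|[|]].
    by rewrite -(eqp_dvdl _ eqg) dvdp_gcdr.
  by case; rewrite szE; move: h1 h2; case: (size g') => [|[|x]] //; 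
     case: (size r') => [|[|y]] // _ _; rewrite !addSn !addnS /= !ltnS ?leq_addl ?leq_addr.
have lift C : P %| C -> divides P C.
  move/Pdiv.Idomain.dvdpP => [[c r1] /= cn0 E].
  apply: (@primitive_dvd_strip _ c) => //; exists r1.
  by rewrite mul_polyC E mulrC.
case=> [/lift|cop]; first by left.
right; apply: lift; rewrite -(Gauss_dvdpr _ cop) ABE.
exact: dvdp_mulr.
Qed.

Theorem factorial_poly : factorial_ring {poly R}.
Proof.
have key l : {in l, forall q : R, prime_elt q} ->
    exists2 L : seq {poly R}, {in L, forall q : {poly R}, prime_elt q} &
      (\prod_(q <- l) q)%:P = \prod_(q <- L) q.
  move=> lP; exists (map polyC l); last by rewrite big_map rmorph_prod.
  by move=> Q /mapP [q ql ->]; apply/prime_polyC/lP.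
move=> P; have [n] := ubnP (size P); elim: n => // n IH in P *.
move=> szP Pn0.
have [a [P' [an0 PE P'p]]] := primitive_part Pn0.
have [u [l [uU lP aE]]] := ufdR an0.
have [L LP LE] := key l lP.
have P'n0 : P' != 0 by apply: contraNneq Pn0 => z; rewrite PE z mulr0.
have szP' : size P' = size P by rewrite PE mul_polyC size_scale.
suff [v [M [vU MP P'E]]] : exists v, exists M : seq {poly R},
   [/\ v \is a GRing.unit, {in M, forall q : {poly R}, prime_elt q} & P' = v * \prod_(q <- M) q].
  exists (u%:P * v), (L ++ M); split.
  - by rewrite unitrM vU andbT; apply: rmorph_unit.
  - by move=> q; rewrite mem_cat => /orP[/LP|/MP].
  - by rewrite PE P'E aE polyCM LE big_cat /= mulrACA.
have [h|h] := leqP (size P') 1.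
  have [c cE] : exists c, P' = c%:P by exists P'`_0; apply: size1_polyC.
  have cn0 : c != 0 by rewrite -polyC_eq0 -cE.
  have [v [m [vU mP mE]]] := ufdR cn0.
  have [M MP ME] := key m mP.
  exists v%:P, M; split => //; first by apply: rmorph_unit.
  by rewrite cE mE polyCM ME.
have [[A [B [ABE ltA ltB]]]|irr] :=
  EM (exists A B, [/\ P' = A * B, (size A < size P')%N & (size B < size P')%N]).
  have An0 : A != 0 by apply: contraNneq P'n0 => z; rewrite ABE z mul0r.
  have Bn0 : B != 0 by apply: contraNneq P'n0 => z; rewrite ABE z mulr0.
  have [|v1 [M1 [v1U M1P AE]]] := IH A _ An0.
    by apply: leq_trans ltA _; rewrite szP' -ltnS.
  have [|v2 [M2 [v2U M2P BE]]] := IH B _ Bn0.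
    by apply: leq_trans ltB _; rewrite szP' -ltnS.
  exists (v1 * v2), (M1 ++ M2); split.
  - by rewrite unitrM v1U.
  - by move=> q; rewrite mem_cat => /orP[/M1P|/M2P].
  - by rewrite ABE AE BE big_cat /= mulrACA.
exists 1, [:: P']; split; rewrite ?unitr1 ?big_seq1 ?mul1r //.
move=> Q; rewrite inE => /eqP ->; apply: primitive_irreducible_prime => //.
by move=> A B E l1 l2; apply: irr; exists A, B.
Qed.

End Gauss.

Lemma factorial_field (K : fieldType) : factorial_ring K.
Proof. by move=> a an0; exists a, [::]; rewrite unitfE big_nil mulr1. Qed.

(** * Polynomial differential equations *)

Section Derivations.
Variable R : comNzRingType.
Implicit Types (P Q : {poly R}).

Definition leibniz (T : pzRingType) (D : T -> T) := forall a b, D (a * b) = D a * b + a * D b.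

Lemma map_deriv_leibniz (D : {additive R -> R}) : leibniz D -> leibniz (map_poly D).
Proof.
move=> DM P Q; apply/polyP => i.
rewrite coefD !coefM coef_map coefM raddf_sum -big_split /=.
by apply: eq_bigr => j _; rewrite DM !coef_map.
Qed.

Lemma deriv_horner (D : {additive R -> R}) P h : leibniz D ->
  D P.[h] = (map_poly D P).[h] + P^`().[h] * D h.
Proof.
move=> DM; elim/poly_ind: P => [|P c IH].
  by rewrite linear0 !raddf0 !horner0 mul0r addr0 raddf0.
have -> : map_poly D (P * 'X + c%:P) = map_poly D P * 'X + (D c)%:P.
  rewrite raddfD /= map_polyC; congr (_ + _); apply/polyP => i.
  by rewrite coef_map !coefMX coef_map; case: i => [|i] //=; rewrite raddf0.
rewrite derivD derivC addr0 derivM derivX mulr1.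
rewrite !(hornerMX, hornerD, hornerM, hornerX, hornerC) raddfD /= DM IH.
by ring.
Qed.

End Derivations.

Section Hessian.
Variable B : comNzRingType.
Implicit Types (P Q : {poly B}) (D : {additive {poly B} -> {poly B}}).

(* For [D] the derivation in [x], vanishes at the inflection points of the sections of the
   surface [Q = 0] by the planes [y = const]; similarly for [y]. *)
Definition inflection (D : {poly B} -> {poly B}) Q :=
  D (D Q) * Q^`() ^+ 2 - 2%:R * D Q^`() * D Q * Q^`() + Q^`()^`() * (D Q) ^+ 2.

(** Here [phi] is restriction to a line of constant slope [b]. One differentiation of [phi Q = 0]
    expresses [phi (D Q)] through the derivative in the main variable; after this substitution the
    inflection polynomial is a multiple of the second derivative of [phi Q]. *)
Lemma inflection_line (D : {poly B} -> {poly B}) (Z : comNzRingType)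
    (phi : {rmorphism {poly B} -> {poly Z}}) (b : {poly Z}) Q :
  (forall P, (D P)^`() = D P^`()) ->
  (forall P, (phi P)^`() = phi (D P) + b * phi P^`()) -> b^`() = 0 ->
  phi Q = 0 -> phi (inflection D Q) = 0.
Proof.
move=> DC chain b0 Q0.
have e1 := chain Q; rewrite Q0 deriv0 in e1.
have e2 := congr1 (@deriv Z) e1.
rewrite deriv0 derivD derivM b0 mul0r add0r !chain DC in e2.
have E1 : phi (D Q) = - (b * phi Q^`()).
  by apply/eqP; rewrite -addr_eq0 -e1.
rewrite /inflection rmorphD rmorphB !rmorphM ?rmorphXn /= rmorph_nat E1.
transitivity ((phi Q^`()) ^+ 2 * (phi (D (D Q)) + b * phi (D Q^`()) +
   b * (phi (D Q^`()) + b * phi Q^`()^`()))); first by ring.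
by rewrite -e2 mulr0.
Qed.

End Hessian.

Section ODE.
Variables (R : idomainType) (p : nat).
Hypothesis pR : p \in [pchar R].

Lemma natf_neq0_lt m : (0 < m < p)%N -> m%:R != 0 :> R.
Proof.
case/andP=> m0 mp; rewrite -(dvdn_pcharf pR); apply/negP => /(dvdn_leq m0).
by rewrite leqNgt mp.
Qed.

(* Comparing orders of vanishing at [x0]: if [phi] vanishes to order exactly
   [m < p], [m >= 2], then the left-hand side vanishes to order [m - 2] only. *)
Lemma ode_unique (a b c phi : {poly R}) x0 :
  a * phi^`()^`() = b * phi^`() + c * phi -> ~~ root a x0 ->
  root phi x0 -> root phi^`() x0 -> (size phi <= p)%N -> phi = 0.
Proof.
move=> ode a0 r0 r1 szp; apply/eqP/negPn/negP => phin0.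
have [m [q [qn0 phiE]]] := multiplicity_XsubC phi x0.
rewrite phin0 /= in qn0.
case: m phiE => [|[|m]] phiE.
- by rewrite phiE expr0 mulr1 (negPf qn0) in r0.
- move: r1; rewrite phiE expr1 derivM derivXsubC mulr1 rootE !hornerE subrr mulr0 add0r.
  by rewrite -rootE (negPf qn0).
have qq : q != 0 by apply: contraNneq qn0 => ->; apply: root0.
have mp : (m.+2 < p)%N.
  apply: leq_trans szp; rewrite phiE size_Mmonic ?monic_exp ?monicXsubC //.
  rewrite size_exp_XsubC addnS /=.
  by rewrite -[ltnLHS]add0n ltn_add2r size_poly_gt0.
set X := 'X - x0%:P in phiE *.
have dX k : (X ^+ k.+1)^`() = X ^+ k *+ k.+1.
  by rewrite deriv_exp derivXsubC mul1r.
pose q1 := q^`() * X + q *+ m.+2.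
have phi1 : phi^`() = X ^+ m.+1 * q1.
  rewrite phiE derivM dX /q1 [RHS]mulrDr; congr (_ + _); last by rewrite !mulrnAr mulrC.
  by rewrite exprSr mulrCA.
have phi2 : phi^`()^`() = X ^+ m * (q1^`() * X + q1 *+ m.+1).
  rewrite phi1 derivM dX [RHS]mulrDr addrC; congr (_ + _); last by rewrite mulrnAl mulrnAr.
  by rewrite exprSr -mulrA [X * _]mulrC.
have X0 : X ^+ m != 0 by rewrite expf_neq0 // polyXsubC_eq0.
have : a * (q1^`() * X + q1 *+ m.+1) = X * (b * q1 + c * (q * X)).
  apply: (mulfI X0); rewrite mulrCA -phi2 ode phi1 phiE !exprSr.
  move: (X ^+ m) (X) => Y Z; ring.
(* At [x0] only [a(x0) q(x0) (m + 1) (m + 2)] survives, and [m + 2 < p] keeps both integers nonzero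
   in [R]. *)
move/(congr1 (horner_eval x0)); rewrite /horner_eval /X /q1 !(hornerMn, hornerXsubC, hornerM, hornerD).
rewrite !subrr !(mulr0, mul0r, add0r).
rewrite -mulrnA -mulr_natr natrM => /eqP; apply/negP.
by rewrite !mulf_neq0 ?natf_neq0_lt //= ltnW.
Qed.

End ODE.

(** * Surfaces and lines in three-space *)

Lemma size_sum_le (R : nzRingType) I (r : seq I) (P : pred I) (F : I -> {poly R}) n :
  (forall i, P i -> size (F i) <= n)%N -> (size (\sum_(i <- r | P i) F i)%R <= n)%N.
Proof.
move=> h; apply: (big_ind (fun q : {poly R} => size q <= n)%N) => //.
  by rewrite size_poly0.
by move=> p q hp hq; apply: leq_trans (size_polyD _ _) _; rewrite geq_max hp.
Qed.

Lemma size_mul_le (R : nzRingType) (p q : {poly R}) m n :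
  (size p <= m.+1 -> size q <= n.+1 -> size (p * q)%R <= (m + n).+1)%N.
Proof.
move=> hp hq; apply: leq_trans (size_polyMleq _ _) _.
by move: hp hq; case: (size p) (size q) => [|x] [|y] /=; lia.
Qed.

Lemma size_exp_le (R : nzRingType) (p : {poly R}) m n :
  (size p <= m.+1 -> size (p ^+ n)%R <= (n * m).+1)%N.
Proof.
move=> hp; elim: n => [|n IH]; first by rewrite expr0 size_poly1.
by rewrite exprS mulSn; apply: size_mul_le.
Qed.

Lemma size_mulrn_le (R : nzRingType) (p : {poly R}) k n : (size p <= n -> size (p *+ k)%R <= n)%N.
Proof.
move=> hp; apply/leq_sizeP => j hj; rewrite coefMn.
by have /leq_sizeP -> := hp; rewrite ?mul0rn.
Qed.

Lemma size_deriv_le (R : nzRingType) (p : {poly R}) n : (size p <= n -> size p^`() <= n)%N.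
Proof.
move=> hp; apply/leq_sizeP => j hj; rewrite coef_deriv.
have /leq_sizeP -> := hp; rewrite ?mul0rn //; exact: leq_trans hj _.
Qed.

Lemma size_det_le (R : comNzRingType) n (M : 'M[{poly R}]_n) (r : 'I_n -> nat) :
  (forall i j, size (M i j) <= (r i).+1)%N -> (size (\det M)%R <= (\sum_i r i).+1)%N.
Proof.
move=> h; rewrite /determinant; apply: size_sum_le => s _.
rewrite mulr_sign; set q := \prod_i _; suff: (size q <= (\sum_i r i).+1)%N.
  by case: ifP => // _; rewrite size_polyN.
rewrite {}/q; apply: (big_ind2 (fun (q : {poly R}) m => size q <= m.+1)%N) => //.
- by rewrite size_poly1.
- by move=> q m q' m'; apply: size_mul_le.
Qed.

(** Row-wise degree bounds in the Sylvester determinant: at most [a'] rows hold coefficients of [p],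
    and at most [a] rows coefficients of [q]. *)
Lemma size_resultant_le (R : comNzRingType) (p q : {poly {poly R}}) a b a' b' :
  (size p <= a.+1 -> size q <= a'.+1 -> (forall i, size (p`_i)%R <= b.+1) ->
   (forall i, size (q`_i)%R <= b'.+1) -> size (resultant p q)%R <= (a' * b + a * b').+1)%N.
Proof.
move=> pa qa pb qb; rewrite /resultant.
pose r (i : 'I_((size q).-1 + (size p).-1)) := if split i is inl _ then b else b'.
have h i j : (size (Sylvester_mx p q i j) <= (r i).+1)%N.
  rewrite Sylvester_mxE /r; case: (split i) => k; exact: size_mulrn_le.
apply: leq_trans (size_det_le h) _; rewrite ltnS big_split_ord /=.
apply: leq_add.
  rewrite (eq_bigr (fun=> b)) => [|i _].
    by rewrite sum_nat_const card_ord leq_mul2r -subn1 leq_subLR add1n ?pa ?qa orbT.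
  by rewrite /r; case: split_ordP => [//|j /eqP]; rewrite eq_lrshift.
rewrite (eq_bigr (fun=> b')) => [|i _].
  by rewrite sum_nat_const card_ord leq_mul2r -subn1 leq_subLR add1n ?pa ?qa orbT.
by rewrite /r; case: split_ordP => [j /eqP|//]; rewrite eq_rlshift.
Qed.

Lemma deriv_map_additive (R S : nzRingType) (D : {additive R -> S}) (P : {poly R}) :
  (map_poly D P)^`() = map_poly D P^`().
Proof. by apply/polyP => i; rewrite !(coef_map, coef_deriv) /= raddfMn. Qed.

Section Trivariate.
Variable K : fieldType.
(* Polynomials in [x], [y], [w], nested in this order. *)
Notation C := {poly {poly {poly K}}}.
Implicit Types (P Q : C) (f g : {poly K}) (s t : K).

Definition deriv_y : C -> C := map_poly (@deriv {poly K}).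
Definition deriv_x : C -> C := map_poly (map_poly (@deriv K)).
HB.instance Definition _ := GRing.Additive.on deriv_y.
HB.instance Definition _ := GRing.Additive.on deriv_x.

(* Restrictions of [Q] to the lines [w = f(x), y = s] and [w = g(y), x = t]. *)
Definition on_x s f : C -> {poly K} := horner_eval s%:P \o horner_eval f%:P.
Definition on_y t g : C -> {poly K} :=
  map_poly (horner_eval t) \o horner_eval (map_poly polyC g).
HB.instance Definition _ s f := GRing.RMorphism.on (on_x s f).
HB.instance Definition _ t g := GRing.RMorphism.on (on_y t g).

Lemma deriv_leibniz (R : comNzRingType) : leibniz (@deriv R).
Proof. by move=> a b; rewrite derivM. Qed.

Lemma deriv_yM : leibniz deriv_y.
Proof. exact/map_deriv_leibniz/deriv_leibniz. Qed.

Lemma deriv_yw P : (deriv_y P)^`() = deriv_y P^`().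
Proof. exact: deriv_map_additive. Qed.

Lemma deriv_xw P : (deriv_x P)^`() = deriv_x P^`().
Proof. exact: deriv_map_additive. Qed.

Lemma deriv_xy P : deriv_y (deriv_x P) = deriv_x (deriv_y P).
Proof. by apply/polyP => i; rewrite !coef_map /= deriv_map_additive. Qed.

Lemma on_x_deriv s f P :
  (on_x s f P)^`() = on_x s f (deriv_x P) + f^`() * on_x s f P^`().
Proof.
rewrite /on_x /= /horner_eval.
rewrite (deriv_horner (D := @deriv K)); last exact: deriv_leibniz.
rewrite /= derivC mulr0 addr0 (deriv_horner (D := map_poly (@deriv K))); last first.
  exact/map_deriv_leibniz/deriv_leibniz.
by rewrite /= map_polyC hornerD hornerM hornerC mulrC.
Qed.

Lemma on_y_deriv t g P :
  (on_y t g P)^`() = on_y t g (deriv_y P) + g^`() * on_y t g P^`().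
Proof.
have Eg (h : {poly K}) : map_poly (horner_eval t) (map_poly polyC h) = h.
  by rewrite -map_poly_comp map_poly_id // => c _; rewrite /= /horner_eval hornerC.
rewrite /on_y /= deriv_map.
have -> : (horner_eval (map_poly polyC g) P)^`() =
    (deriv_y P).[map_poly polyC g] + P^`().[map_poly polyC g] * map_poly polyC g^`().
  by rewrite -deriv_map; apply: deriv_horner; apply: deriv_leibniz.
by rewrite rmorphD rmorphM /= Eg mulrC.
Qed.

Lemma on_x_inflection s f Q : f^`()^`() = 0 -> on_x s f Q = 0 ->
  on_x s f (inflection deriv_x Q) = 0.
Proof. by apply: inflection_line; [apply: deriv_xw|apply: on_x_deriv]. Qed.

Lemma on_y_inflection t g Q : g^`()^`() = 0 -> on_y t g Q = 0 ->
  on_y t g (inflection deriv_y Q) = 0.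
Proof. by apply: inflection_line; [apply: deriv_yw|apply: on_y_deriv]. Qed.

Lemma on_xX s f : on_x s f 'X = f.
Proof. by rewrite /on_x /= /horner_eval hornerX hornerC. Qed.

Lemma on_xC s f c : on_x s f c%:P = c.[s%:P].
Proof. by rewrite /on_x /= /horner_eval hornerC. Qed.

Lemma on_yX t g : on_y t g 'X = g.
Proof.
rewrite /on_y /= [horner_eval _ 'X]hornerX -map_poly_comp map_poly_id // => c _.
by rewrite /= /horner_eval hornerC.
Qed.

Lemma on_yC t g c : on_y t g c%:P = map_poly (horner_eval t) c.
Proof. by rewrite /on_y /= [horner_eval _ c%:P]hornerC. Qed.

(** Both sides are the value of [P] at the common point [(x, y, w) = (t, s, f(t))] of the two
    lines. *)
Lemma on_xy s f t g P : f.[t] = g.[s] -> (on_x s f P).[t] = (on_y t g P).[s].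
Proof.
move=> fg; elim/poly_ind: P => [|P c IH]; first by rewrite !raddf0 !horner0.
rewrite !rmorphD !rmorphM !hornerD !hornerM IH /= on_xX on_yX on_xC on_yC fg.
have -> : (map_poly (horner_eval t) c).[s] = (map_poly (horner_eval t) c).[horner_eval t s%:P].
  by rewrite /horner_eval hornerC.
by rewrite horner_map.
Qed.

(* Bounds for the degrees in [w], [y] and [x], in this order. *)
Definition tri_deg a b c P :=
  [/\ size P <= a.+1, forall i, size (P`_i)%R <= b.+1 & forall i j, size (P`_i`_j)%R <= c.+1]%N.

Lemma tri_degD a b c P Q : tri_deg a b c P -> tri_deg a b c Q -> tri_deg a b c (P + Q).
Proof.
move=> [p1 p2 p3] [q1 q2 q3]; split=> [|i|i j]; rewrite ?coefD;
  by apply: leq_trans (size_polyD _ _) _; rewrite geq_max ?p1 ?q1 ?p2 ?q2 ?p3 ?q3.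
Qed.

Lemma tri_degN a b c P : tri_deg a b c P -> tri_deg a b c (- P).
Proof. by move=> [p1 p2 p3]; split=> [|i|i j]; rewrite ?coefN size_polyN. Qed.

Lemma tri_degM a b c a' b' c' P Q : tri_deg a b c P -> tri_deg a' b' c' Q ->
  tri_deg (a + a') (b + b') (c + c') (P * Q).
Proof.
move=> [p1 p2 p3] [q1 q2 q3]; split=> [|i|i j]; first exact: size_mul_le.
  by rewrite coefM; apply: size_sum_le => k _; apply: size_mul_le.
rewrite coefM coef_sum; apply: size_sum_le => k _; rewrite coefM.
by apply: size_sum_le => l _; apply: size_mul_le.
Qed.

Lemma tri_deg_nat a b c n : tri_deg a b c n%:R.
Proof.
have pos (R : nzRingType) (q : {poly R}) m : (size q <= 1 -> size q <= m.+1)%N.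
  by move/leq_trans; apply.
have sn (R : nzRingType) : (size (n%:R : {poly R}) <= 1)%N by rewrite -polyC_natr size_polyC_leq1.
rewrite -!polyC_natr; split=> [|i|i j]; rewrite ?coefC -?polyC_natr.
- exact/pos/size_polyC_leq1.
- by case: eqP => _; rewrite ?size_poly0 //; apply/pos/size_polyC_leq1.
case: eqP => _; rewrite coefC; case: eqP => _; rewrite ?size_poly0 //.
by apply: pos; rewrite ?sn ?size_polyC_leq1.
Qed.

Lemma tri_deg_derivw a b c P : tri_deg a b c P -> tri_deg a b c P^`().
Proof.
move=> [p1 p2 p3]; split=> [|i|i j]; rewrite ?coef_deriv ?coefMn.
- exact: size_deriv_le.
- exact: size_mulrn_le.
- exact: size_mulrn_le.
Qed.

Lemma tri_deg_derivy a b c P : tri_deg a b c P -> tri_deg a b c (deriv_y P).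
Proof.
move=> [p1 p2 p3]; split=> [|i|i j]; rewrite /deriv_y ?coef_map /= ?coef_deriv.
- exact: leq_trans (size_poly _ _) _.
- exact: (size_deriv_le (p2 i)).
- exact: (size_mulrn_le _ (p3 i j.+1)).
Qed.

Lemma tri_deg_derivx a b c P : tri_deg a b c P -> tri_deg a b c (deriv_x P).
Proof.
move=> [p1 p2 p3]; split=> [|i|i j]; rewrite /deriv_x ?coef_map /= ?coef_map /=.
- exact: leq_trans (size_poly _ _) _.
- exact: leq_trans (size_poly _ _) (p2 i).
- exact: (size_deriv_le (p3 i j)).
Qed.

Lemma tri_deg_inflection (D : C -> C) a b c Q :
  (forall P, tri_deg a b c P -> tri_deg a b c (D P)) -> tri_deg a b c Q ->
  tri_deg (3 * a) (3 * b) (3 * c) (inflection D Q).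
Proof.
move=> hD hQ; have hw := tri_deg_derivw.
have E n : (3 * n = n + (n + n))%N by lia.
have E' n : (3 * n = 0 + n + n + n)%N by lia.
apply: tri_degD; [apply: tri_degD; last apply: tri_degN|].
- by rewrite !E expr2; apply: tri_degM; [|apply: tri_degM]; auto.
- rewrite !E'; apply: tri_degM; last exact: hw.
  by apply: tri_degM; [apply: tri_degM; [apply: tri_deg_nat|]|]; auto.
- by rewrite !E expr2; apply: tri_degM; [|apply: tri_degM]; auto.
Qed.

Lemma size_on_x a b c s f Q : (size f <= 2)%N -> tri_deg a b c Q ->
  (size (on_x s f Q) <= (a + c).+1)%N.
Proof.
move=> f2 [q1 q2 q3]; rewrite /on_x /= /horner_eval (horner_coef Q) horner_sum.
apply: size_sum_le => -[i] /= hi _; rewrite hornerM horner_exp hornerC mulrC.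
have ia : (i <= a)%N by rewrite -ltnS (leq_trans hi).
apply: (@leq_trans (i * 1 + c).+1); last by rewrite muln1 ltnS leq_add2r.
apply: size_mul_le; first exact: size_exp_le.
rewrite horner_coef; apply: size_sum_le => -[j] /= hj _.
rewrite -[c]addn0; apply: size_mul_le => //.
by rewrite -polyC_exp size_polyC_leq1.
Qed.

Lemma size_on_y a b c t g Q : (size g <= 2)%N -> tri_deg a b c Q ->
  (size (on_y t g Q) <= (a + b).+1)%N.
Proof.
move=> g2 [q1 q2 q3]; rewrite /on_y /= /horner_eval (horner_coef Q).
apply: leq_trans (size_poly _ _) _.
apply: size_sum_le => -[i] /= hi _; rewrite mulrC.
have ia : (i <= a)%N by rewrite -ltnS (leq_trans hi).
apply: (@leq_trans (i * 1 + b).+1); last by rewrite muln1 ltnS leq_add2r.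
apply: size_mul_le => //; apply: size_exp_le.
exact: leq_trans (size_poly _ _) _.
Qed.

End Trivariate.

(** * Lines common to two surfaces *)

(** The gcd divides [Q] and [H] only up to constants. By primality [Q] divides the gcd or its
    cofactor in [Q]: the first would make [Q] divide [H], the second is excluded by degree. *)
Lemma prime_coprimep (R : idomainType) (Q H : {poly R}) :
  prime_elt Q -> (1 < size Q)%N -> ~ divides Q H -> coprimep Q H.
Proof.
move=> [Q0 QU QP] szQ QH; apply: contrapT => /negP; rewrite coprimep_def.
set g := gcdp Q H => szg.
have gn0 : g != 0 by rewrite gcdp_eq0 negb_and Q0.
have szg1 : (1 < size g)%N.
  by move: szg gn0; rewrite -size_poly_gt0; case: (size g) => [|[|]].
have /Pdiv.Idomain.dvdpP [[c r] /= cn0 E] : g %| Q by apply: dvdp_gcdl.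
have /Pdiv.Idomain.dvdpP [[c' r'] /= cn0' E'] : g %| H by apply: dvdp_gcdr.
have QC d : d != 0 -> ~ divides Q d%:P.
  move=> dn0 [x /(congr1 (fun p : {poly R} => size p))].
  have [->|xn0] := eqVneq x 0; first by rewrite mulr0 size_poly0 size_polyC dn0.
  rewrite size_mul // size_polyC dn0 /=.
  by move: szQ xn0; rewrite -size_poly_gt0; case: (size Q) (size x) => [|[|a]] [|b] //=; lia.
have : divides Q (r * g) by exists c%:P; rewrite -E -mul_polyC mulrC.
case/QP => -[x xE].
  have : c%:P = x * g.
    by apply: (mulfI Q0); rewrite mulrC mul_polyC E xE -mulrA.
  move/(congr1 (fun p : {poly R} => size p)).
  have [->|xn0] := eqVneq x 0; first by rewrite mul0r size_poly0 size_polyC cn0.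
  rewrite size_mul // size_polyC cn0 /=.
  by move: szg1 xn0; rewrite -size_poly_gt0; case: (size g) (size x) => [|[|a]] [|b] //=; lia.
have : divides Q (c'%:P * H).
  by exists (r' * x); rewrite mul_polyC E' xE mulrCA.
by case/QP => // /(QC _ cn0').
Qed.

Lemma max_card_roots (K : idomainType) (V : finType) (sg : V -> K) (R : {set V}) (r : {poly K}) :
  injective sg -> r != 0 -> {in R, forall i, root r (sg i)} -> (#|R| < size r)%N.
Proof.
move=> inj r0 h; rewrite cardE -(size_map sg); apply: max_poly_roots => //.
- by apply/allP => x /mapP [i]; rewrite mem_enum => /h hi ->.
- by rewrite map_inj_uniq ?enum_uniq.
Qed.

Lemma leibniz_inflection (T : comNzRingType) (delta : T -> T) (a b c d e : T) :
  leibniz delta -> {morph delta : x y / x + y} -> {morph delta : x / - x} ->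
  delta (a * b ^+ 2 - 2%:R * c * d * b + e * d ^+ 2) =
  delta a * b ^+ 2 + 2%:R * a * b * delta b
  - 2%:R * (delta c * d * b + c * delta d * b + c * d * delta b)
  + delta e * d ^+ 2 + 2%:R * e * d * delta d.
Proof.
move=> dM dD dN; have d1 : delta 1 = 0.
  by have := dM 1 1; rewrite !mul1r mulr1 => /eqP; rewrite -subr_eq subrr eq_sym => /eqP.
by rewrite !expr2 !(dD, dN) !dM !(dD, dN) d1; ring.
Qed.

Section Surface.
Variables (K : fieldType) (V : finType) (sg al be : V -> K).
Hypothesis sg_inj : injective sg.
Notation C := {poly {poly {poly K}}}.
Implicit Types (P Q : C) (R : {set V}).

Definition line i : {poly K} := (al i)%:P + (be i) *: 'X.
Local Notation Lx i := (on_x (sg i) (line i)).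
Local Notation Ly i := (on_y (sg i) (line i)).

Lemma size_line i : (size (line i) <= 2)%N.
Proof.
apply: leq_trans (size_polyD _ _) _; rewrite geq_max.
rewrite (leq_trans (size_polyC_leq1 _)) //=.
by apply: leq_trans (size_scale_leq _ _) _; rewrite size_polyX.
Qed.

Lemma line_deriv i : (line i)^`() = (be i)%:P.
Proof. by rewrite derivD derivC derivZ derivX add0r -mul_polyC mulr1. Qed.

Lemma line_deriv2 i : (line i)^`()^`() = 0.
Proof. by rewrite line_deriv derivC. Qed.

(** The resultant in [w] is a nonzero polynomial in [y] over [K[x]]. It vanishes at every [sg i],
    because [y] is constant on a line of the first kind. *)
Lemma common_lines Q H a b c a' b' c' R : prime_elt Q -> (1 < size Q)%N -> ~ divides Q H ->
  tri_deg a b c Q -> tri_deg a' b' c' H ->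
  {in R, forall i, Lx i Q = 0 /\ Lx i H = 0} -> (#|R| <= a' * b + a * b')%N.
Proof.
move=> Qpr szQ QH [Q1 Q2 _] [H1 H2 _] hR.
have inj : injective (fun i => (sg i)%:P) by move=> i j /polyC_inj /sg_inj.
have a0 : (0 < a)%N by rewrite -ltnS (leq_trans szQ).
have [szH|szH] := ltnP 1 (size H).
  have [[u v] /= _ E] := resultant_in_ideal szQ szH.
  have r0 : resultant Q H != 0.
    rewrite resultant_eq0 -leqNgt.
    by have := prime_coprimep Qpr szQ QH; rewrite coprimep_def => /eqP ->.
  have hroot : {in R, forall i, root (resultant Q H) (sg i)%:P}.
    move=> i /hR [LQ LH]; rewrite rootE -(on_xC _ (line i)) E.
    by rewrite rmorphD !rmorphM /= LQ LH !mulr0 addr0.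
  rewrite -ltnS; apply: leq_trans (max_card_roots inj r0 hroot) _.
  exact: size_resultant_le.
(* If [H] does not involve [w], its only coefficient replaces the resultant. *)
have HE : H = (H`_0)%:P by apply: size1_polyC.
have H0 : H`_0 != 0.
  rewrite -polyC_eq0 -HE; apply: contra_notN QH => /eqP ->.
  by exists 0; rewrite mulr0.
have hroot : {in R, forall i, root H`_0 (sg i)%:P}.
  by move=> i /hR [_ LH]; rewrite rootE -(on_xC _ (line i)) -HE LH.
rewrite -ltnS; apply: leq_trans (max_card_roots inj H0 hroot) _.
apply: leq_trans (H2 0) _; rewrite ltnS; nia.
Qed.

(** A root [h] in [w] gives the factor [w - h], and the prime [Q] is then an associate of it. *)
Lemma ruled_factor Q (h : {poly {poly K}}) : prime_elt Q -> Q.[h] = 0 ->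
  forall i, Lx i Q = 0 -> line i = h.[(sg i)%:P].
Proof.
move=> [Q0 QU QP] Qh i LQ.
have /factor_theorem [q qE] : root Q h by apply/eqP.
have : divides Q (q * ('X - h%:P)) by exists 1; rewrite mulr1.
case/QP => -[r rE].
  exfalso; have : 'X - h%:P \is a GRing.unit.
    apply/unitrPr; exists r; apply: (mulfI Q0); rewrite mulr1 {2}qE rE; ring.
  by rewrite poly_unitE size_XsubC.
have E : Lx i ('X - h%:P) = line i - h.[(sg i)%:P].
  by rewrite (raddfB (on_x (sg i) (line i) : {additive _ -> _})) /= on_xX on_xC.
by apply/eqP; rewrite -subr_eq0 -E rE (rmorphM (on_x (sg i) (line i))) /= LQ mul0r.
Qed.

(* Along the line [Lx i], the slope in the [y]-direction is [N / D]; the vanishing of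
   the [x]-inflection to first order in [y] says exactly that [(N / D)'' = 0]. *)
Lemma slope_ode Q U i : inflection (@deriv_x K) Q = Q * U -> Lx i Q = 0 ->
  let D := Lx i Q^`() in let N := - Lx i (deriv_y Q) in
  D * (D ^+ 2 * N^`()^`() - 2%:R * D * D^`() * N^`() - N * D * D^`()^`()
        + 2%:R * N * D^`() ^+ 2) = 0.
Proof.
move=> QU LQ D N.
have chain P : (Lx i P)^`() = Lx i (deriv_x P) + (be i)%:P * Lx i P^`().
  by rewrite on_x_deriv line_deriv.
pose b := (be i)%:P.
have b0 : b^`() = 0 by rewrite derivC.
have DE : D^`() = Lx i (deriv_x Q^`()) + b * Lx i Q^`()^`() by rewrite chain.
have NE : N^`() = - (Lx i (deriv_x (deriv_y Q)) + b * Lx i (deriv_y Q^`())).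
  by rewrite /N derivN chain deriv_yw.
have DDE : D^`()^`() = Lx i (deriv_x (deriv_x Q^`())) + b * Lx i (deriv_x Q^`()^`())
     + b * (Lx i (deriv_x Q^`()^`()) + b * Lx i Q^`()^`()^`()).
  by rewrite DE derivD derivM b0 mul0r add0r !chain deriv_xw.
have NNE : N^`()^`() = - (Lx i (deriv_x (deriv_x (deriv_y Q))) + b * Lx i (deriv_x (deriv_y Q^`()))
     + b * (Lx i (deriv_x (deriv_y Q^`())) + b * Lx i (deriv_y Q^`()^`()))).
  by rewrite NE derivN derivD derivM b0 mul0r add0r !chain deriv_xw !deriv_yw.
have e1 : Lx i (deriv_x Q) = - (b * D).
  have := chain Q; rewrite LQ deriv0 => /esym/eqP.
  by rewrite addr_eq0 => /eqP ->.
have e2 : Lx i (deriv_x (deriv_x Q)) = - (b * Lx i (deriv_x Q^`())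
     + b * (Lx i (deriv_x Q^`()) + b * Lx i Q^`()^`())).
  have E := congr1 (@deriv _) e1; rewrite derivN derivM b0 mul0r add0r DE chain deriv_xw in E.
  by apply/eqP; rewrite -addr_eq0 addrA E addNr.
have hy := congr1 (fun P => Lx i (deriv_y P)) QU.
have hw := congr1 (fun P => Lx i P^`()) QU.
rewrite /= deriv_yM rmorphD !rmorphM /= LQ mul0r addr0 in hy.
rewrite /= derivM rmorphD !rmorphM /= LQ mul0r addr0 in hw.
(* The direction [(D, N)] in [(y, w)] is tangent to the surface along the line, so the derivative of
   [Q * U] in this direction vanishes there and [U] disappears. *)
have key : D * Lx i (deriv_y (inflection (@deriv_x K) Q)) +
           N * Lx i (inflection (@deriv_x K) Q)^`() = 0.
  by rewrite hy hw /N /D; ring.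
move: key.
rewrite /inflection.
rewrite (leibniz_inflection _ _ _ _ _ (@deriv_yM K)); [|exact: raddfD|exact: raddfN].
rewrite (leibniz_inflection _ _ _ _ _ (@deriv_leibniz {poly {poly K}})); [|exact: derivD|exact: derivN].
have LD P1 P2 : Lx i (P1 + P2) = Lx i P1 + Lx i P2 by exact: (raddfD (on_x _ _ : {additive _ -> _})).
have LN P1 : Lx i (- P1) = - Lx i P1 by exact: (raddfN (on_x _ _ : {additive _ -> _})).
have LM P1 P2 : Lx i (P1 * P2) = Lx i P1 * Lx i P2 by exact: (rmorphM (on_x _ _ : {rmorphism _ -> _})).
have L2 : Lx i 2%:R = 2%:R by exact: (rmorph_nat (on_x _ _ : {rmorphism _ -> _})).
rewrite !expr2.
rewrite !(L2, LD, LN, LM).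
rewrite !(deriv_xy, deriv_xw) e2 e1 DDE NNE DE NE -/D.
clear chain LD LN LM L2 DE NE DDE NNE e1 e2 hy hw b0; clearbody D N b; move: D N b.
move: (Lx i (deriv_x (deriv_x (deriv_y Q)))) (Lx i (deriv_x Q^`())) (Lx i Q^`()^`())
  (Lx i (deriv_y Q^`())) (Lx i (deriv_x (deriv_y Q^`()))) (Lx i (deriv_x (deriv_y Q)))
  (Lx i (deriv_y Q^`()^`())) (Lx i (deriv_x (deriv_x Q^`()))) (Lx i (deriv_x Q^`()^`()))
  (Lx i Q^`()^`()^`()) => t1 t2 t3 t4 t5 t6 t7 t8 t9 t10 D N b key.
by rewrite -[RHS]oppr0 -key; ring.
Qed.

End Surface.

(** * Doubly ruled surfaces *)

(** The left-hand side of the equation is [D^3 (N / D)'']; the size bounds rule out solutions such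
    as [x^p]. The linear candidate agrees with [N / D] to first order at [x0], and [ode_unique]
    applies to the difference [psi]. *)
Lemma linear_of_ode (K : fieldType) p (D N : {poly K}) x0 : p \in [pchar K] ->
  D ^+ 2 * N^`()^`() - 2%:R * D * D^`() * N^`() - N * D * D^`()^`()
    + 2%:R * N * D^`() ^+ 2 = 0 ->
  ~~ root D x0 -> (size D < p)%N -> (size N <= p)%N ->
  exists e0 e1, N = (e0%:P + e1 *: 'X) * D.
Proof.
move=> pK ode D0 szD szN.
pose v := N.[x0] / D.[x0].
pose e1 := (N^`().[x0] - v * D^`().[x0]) / D.[x0].
pose e0 := v - e1 * x0.
pose l := e0%:P + e1 *: 'X.
have l0 : l.[x0] = v by rewrite !hornerE /e0 subrK.
have dl : l^`() = e1%:P by rewrite derivD derivC derivZ derivX add0r -mul_polyC mulr1.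
have ddl : l^`()^`() = 0 by rewrite dl derivC.
exists e0, e1; rewrite -/l; apply/eqP; rewrite -subr_eq0; apply/eqP.
set psi := N - l * D.
have d1 : psi^`() = N^`() - (l^`() * D + l * D^`()) by rewrite derivB derivM.
have d2 : psi^`()^`() = N^`()^`() - (2%:R * l^`() * D^`() + l * D^`()^`()).
  rewrite d1 derivB derivD !derivM ddl; congr (_ - _); ring.
have Dx0 : D.[x0] != 0 by [].
apply: (ode_unique (a := D ^+ 2) (b := 2%:R * D * D^`())
                   (c := D * D^`()^`() - 2%:R * D^`() ^+ 2) (x0 := x0) pK).
- have {}ode : D ^+ 2 * N^`()^`() =
    2%:R * D * D^`() * N^`() + (D * D^`()^`() - 2%:R * D^`() ^+ 2) * N.
    by apply/eqP; rewrite -subr_eq0; apply/eqP; rewrite -[RHS]ode; ring.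
  rewrite d2 d1 /psi mulrBr ode.
  move: (l^`()) (D^`()^`()) (N^`()^`()) (D^`()) (N^`()) => *; ring.
- by rewrite rootE hornerM mulf_neq0.
- by rewrite rootE /psi hornerD hornerN hornerM l0 /v divfK // subrr.
- rewrite rootE d1 hornerD hornerN hornerD !hornerM dl hornerC l0 /e1.
  by rewrite divfK // subrK subrr.
- apply: leq_trans (size_polyD _ _) _; rewrite geq_max szN size_polyN.
  apply: leq_trans (size_polyMleq _ _) _.
  have : (size l <= 2)%N.
    apply: leq_trans (size_polyD _ _) _; rewrite geq_max.
    rewrite (leq_trans (size_polyC_leq1 _)) //=.
    by apply: leq_trans (size_scale_leq _ _) _; rewrite size_polyX.
  by move: (size l) (size D) szD => x y; lia.
Qed.

Section Surface.
Variables (K : fieldType) (p : nat) (V : finType) (sg al be : V -> K).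
Hypothesis pK : p \in [pchar K].
Hypothesis sg_inj : injective sg.
Notation C := {poly {poly {poly K}}}.
Implicit Types (P Q : C) (R : {set V}).
Local Notation line := (line al be).
Local Notation Lx i := (on_x (sg i) (line i)).

(** As [d] is the [y]-slope of the surface along the line, the graph [w = line(x) + d(x) (y - sg i)]
    is tangent to the surface there. On this graph [Q] satisfies a second-order linear equation in
    [y] over [K[x]] with zero initial data, and [ode_unique] applies. *)
Lemma ruled_extend Q U a b c i (d : {poly K}) :
  inflection (@deriv_y K) Q = Q * U -> Lx i Q = 0 -> Lx i Q^`() != 0 ->
  Lx i (deriv_y Q) + d * Lx i Q^`() = 0 -> tri_deg a b c Q -> (a + b < p)%N ->
  Q.[(line i)%:P + d%:P * ('X - (sg i)%:P%:P)] = 0.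
Proof.
move=> QU LQ D0 slope [Qa Qb Qc] abp.
set h := _ + _.
have hs : h.[(sg i)%:P] = line i by rewrite !hornerE subrr mulr0 addr0.
have dh : h^`() = d%:P.
  by rewrite derivD derivM !derivC derivXsubC mul0r !add0r mulr1.
have at_s P : P.[h].[(sg i)%:P] = Lx i P.
  have -> : Lx i P = P.[(line i)%:P].[(sg i)%:P] by [].
  rewrite !(horner_coef P) !horner_sum; apply: eq_bigr => j _.
  by rewrite !hornerM !horner_exp hs hornerC.
have chain P : (P.[h])^`() = (deriv_y P).[h] + P^`().[h] * d%:P.
  have := @deriv_horner _ (@deriv {poly K}) P h (@deriv_leibniz {poly K}).
  by rewrite /= dh.
have pA : p \in [pchar {poly K}] by rewrite pchar_poly.
pose g := Q^`().[h].
apply: (ode_unique (a := g ^+ 2) (x0 := (sg i)%:P) pA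
  (b := 2%:R * (deriv_y Q^`()).[h] * g + 2%:R * d%:P * g * Q^`()^`().[h] - Q^`()^`().[h] * Q.[h]^`())
  (c := U.[h])).
- have e1 : (deriv_y Q).[h] = Q.[h]^`() - g * d%:P by rewrite chain addrK.
  have e2 : Q.[h]^`()^`() = (deriv_y (deriv_y Q)).[h] + 2%:R * d%:P * (deriv_y Q^`()).[h]
      + d%:P ^+ 2 * Q^`()^`().[h].
    rewrite chain derivD derivM derivC mulr0 addr0 !chain deriv_yw.
    move: ((deriv_y (deriv_y Q)).[h]) ((deriv_y Q^`()).[h]) (Q^`()^`().[h]) (d%:P) => *; ring.
  have := congr1 (fun P : C => P.[h]) QU.
  rewrite /= hornerM /inflection !(hornerD, hornerN) !(horner_exp, hornerM) -/g e1.
  have -> : (2%:R : C).[h] = 2%:R by rewrite -polyC_natr hornerC.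
  rewrite e2.
  move: (Q.[h]^`()) (Q.[h]) (U.[h]) => q1 q u.
  move: ((deriv_y (deriv_y Q)).[h]) ((deriv_y Q^`()).[h]) (Q^`()^`().[h]) (d%:P) => t1 t2 t3 t4.
  rewrite mulrC => E; apply/eqP; rewrite -subr_eq0; apply/eqP.
  move/eqP: E; rewrite -subr_eq0 => /eqP E; clear e1 e2; clearbody g.
  by rewrite -[RHS]E; ring.
- by rewrite rootE horner_exp at_s expf_neq0.
- by rewrite rootE at_s LQ.
- by rewrite rootE chain hornerD hornerM !at_s hornerC mulrC slope.
have szh : (size h <= 2)%N.
  apply: leq_trans (size_polyD _ _) _; rewrite geq_max.
  rewrite (leq_trans (size_polyC_leq1 _)) //=.
  apply: leq_trans (size_polyMleq _ _) _; rewrite size_XsubC addn2 /=.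
  by rewrite ltnS size_polyC_leq1.
apply: leq_trans abp; rewrite (horner_coef Q).
apply: size_sum_le => -[j] /= hj _; have ja : (j <= a)%N by rewrite -ltnS (leq_trans hj).
apply: (@leq_trans (b + j * 1).+1); last by rewrite muln1 ltnS addnC leq_add2r.
by apply: (size_mul_le (Qb j)); apply: size_exp_le.
Qed.

(** More lines than [common_lines] permits force [Q] to divide both inflection polynomials. The
    [y]-slope along one line of [R] is then linear in [x], and [ruled_extend] with [ruled_factor]
    puts all lines of [Q] on one bilinear surface. *)
Lemma surface_dichotomy Q a b c R : prime_elt Q -> tri_deg a b c Q -> ((a + b + c).+1 < p)%N ->
  (a + c < #|V|)%N ->
  {in R, forall i, Lx i Q = 0 /\ Lx i (inflection (@deriv_y K) Q) = 0} ->
  (3 * (a + b) ^ 2 < #|R|)%N ->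
  (1 < size Q)%N /\ exists c0 c1 c2 c3,
    forall i, Lx i Q = 0 -> al i = c0 + c2 * sg i /\ be i = c1 + c3 * sg i.
Proof.
move=> Qpr Qd abcp acV hR cR.
have [Q0 QU QP] := Qpr; have [Qa Qb Qc] := Qd.
have inj : injective (fun i => (sg i)%:P) by move=> i j /polyC_inj /sg_inj.
have szQ : (1 < size Q)%N.
  rewrite ltnNge; apply/negP => /size1_polyC QE.
  have q0 : Q`_0 != 0 by rewrite -polyC_eq0 -QE.
  have hroot : {in R, forall i, root Q`_0 (sg i)%:P}.
    by move=> i /hR [LQ _]; rewrite rootE -(on_xC _ (line i)) -QE LQ.
  have := leq_trans (max_card_roots inj q0 hroot) (Qb 0).
  by move: cR; rewrite ltnS; nia.
have few H a' b' c' : ~ divides Q H -> tri_deg a' b' c' H -> (a' * b + a * b' <= 3 * (a + b) ^ 2)%N ->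
    {in R, forall i, Lx i H = 0} -> False.
  move=> QH Hd le hH.
  have : (#|R| <= a' * b + a * b')%N.
    apply: (common_lines (al := al) (be := be) sg_inj Qpr szQ QH Qd Hd) => i iR.
    by have [LQ _] := hR i iR; split => //; apply: hH.
  by move/leq_trans => /(_ _ le); rewrite leqNgt cR.
have [U1 U1E] : divides Q (inflection (@deriv_x K) Q).
  apply: contrapT => ndvd; apply: (few _ _ _ _ ndvd (tri_deg_inflection (@tri_deg_derivx K a b c) Qd)).
    nia.
  move=> i /hR [LQ _]; apply: on_x_inflection LQ; exact: line_deriv2.
have [U2 U2E] : divides Q (inflection (@deriv_y K) Q).
  apply: contrapT => ndvd; apply: (few _ _ _ _ ndvd (tri_deg_inflection (@tri_deg_derivy K a b c) Qd)).
    nia.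
  by move=> i /hR [].
have Qa' : (size Q <= p)%N by apply: leq_trans Qa _; lia.
(* The degree of [Q] in [w] is positive and less than [p], so the leading term survives
   differentiation. *)
have dQ0 : Q^`() != 0.
  apply/eqP => dQ; have : Q^`()`_(size Q).-2 = 0 by rewrite dQ coef0.
  rewrite coef_deriv -mulr_natr; move/eqP; rewrite mulf_eq0.
  have -> : (size Q).-2.+1 = (size Q).-1 by move: szQ; case: (size Q) => [|[|]].
  rewrite -lead_coefE lead_coef_eq0 (negPf Q0) /=; apply/negP.
  apply: (@natf_neq0_lt _ p); first by rewrite !pchar_poly.
  by move: szQ Qa'; case: (size Q) => [|[|n]].
have ndQ : ~ divides Q Q^`().
  case=> r rE; have := lt_size_deriv Q0; rewrite rE ltnNge => /negP; apply.
  have r0 : r != 0 by apply: contraNneq dQ0 => r0; rewrite rE r0 mulr0.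
  rewrite size_mul //; move: r0; rewrite -size_poly_gt0.
  by case: (size r) => // n _; rewrite addnS /= leq_addr.
have [i iR Di] : exists2 i, i \in R & Lx i Q^`() != 0.
  apply: contrapT => no; apply: (few _ _ _ _ ndQ (tri_deg_derivw Qd)); first by nia.
  by move=> i iR; apply/eqP/negPn/negP => h; apply: no; exists i.
have [LQ _] := hR i iR.
have szD : (size (Lx i Q^`()) <= (a + c).+1)%N.
  exact: size_on_x (size_line _ _ _) (tri_deg_derivw Qd).
(* The degree on the line is at most [a + c < #|V|], so some [sg j] is a nonsingular point of the
   differential equation. *)
have [j Dj] : exists j, ~~ root (Lx i Q^`()) (sg j).
  apply: contrapT => no.
  have h : {in [set: V], forall j, root (Lx i Q^`()) (sg j)}.
    by move=> j _; apply/negPn/negP => hj; apply: no; exists j.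
  have := leq_trans (max_card_roots sg_inj Di h) szD.
  by rewrite cardsT ltnS leqNgt acV.
have ode := slope_ode U1E LQ.
have {}ode := mulfI Di (etrans ode (esym (mulr0 _))).
have szN : (size (- Lx i (deriv_y Q)) <= p)%N.
  rewrite size_polyN; apply: leq_trans (size_on_x _ (size_line _ _ _) (tri_deg_derivy Qd)) _.
  by move: abcp; clear; lia.
have szD' : (size (Lx i Q^`()) < p)%N by apply: leq_ltn_trans szD _; move: abcp; clear; lia.
have [e0 [e1 NE]] := linear_of_ode pK ode Dj szD' szN.
set d := e0%:P + e1 *: 'X in NE.
have abp : (a + b < p)%N by move: abcp; clear; lia.
have slope : Lx i (deriv_y Q) + d * Lx i Q^`() = 0 by rewrite -NE addrN.
have h := ruled_factor (sg := sg) (al := al) (be := be) Qpr (ruled_extend U2E LQ Di slope Qd abp).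
(* These are the coefficients of [(al i + be i x) + (e0 + e1 x) (y - sg i)]. *)
split=> //; exists (al i - e0 * sg i), (be i - e1 * sg i), e0, e1 => k LQk.
have {h} := h k LQk.
rewrite !hornerE /d /line => E.
have E0 := congr1 (fun P : {poly K} => P`_0) E; have E1 := congr1 (fun P : {poly K} => P`_1) E.
rewrite /= -polyCB in E0 E1.
rewrite !(coefD, coefMC, coefZ, coefX, coefC) /= !(mulr0, addr0, mulr1, add0r) in E0 E1.
by split; [rewrite E0|rewrite E1]; ring.
Qed.

End Surface.

(** * Interpolation and factorization *)

Lemma kernel_vector (K : fieldType) (I J : finType) (M : I -> J -> K) : (#|J| < #|I|)%N ->
  exists2 v : I -> K, exists i, v i != 0 & forall j, \sum_i v i * M i j = 0.
Proof.
move=> ltJI.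
pose A := \matrix_(i < #|I|, j < #|J|) M (enum_val i) (enum_val j).
have kerA : kermx A != 0.
  by rewrite -mxrank_eq0 mxrank_ker subn_eq0 -ltnNge (leq_ltn_trans (rank_leq_col A)).
have [i0 /eqP ri0] : exists i0, row i0 (kermx A) != 0.
  apply: contrapT => no; case/eqP: kerA; apply/row_matrixP => i0.
  by rewrite row0; apply/eqP/negPn/negP => h; apply: no; exists i0.
exists (fun i => row i0 (kermx A) 0 (enum_rank i)).
  apply: contrapT => no; apply: ri0; apply/rowP => j; rewrite [RHS]mxE.
  apply/eqP/negPn/negP => h; apply: no; exists (enum_val j); by rewrite enum_valK.
move=> j.
have := congr1 (fun B : 'M_(_, _) => B i0 (enum_rank j)) (mulmx_ker A).
rewrite !mxE => E; rewrite -[RHS]E (reindex_onto enum_val enum_rank) /=; last first.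
  by move=> i _; rewrite enum_rankK.
rewrite (eq_bigl xpredT) => [|i]; last by rewrite enum_valK eqxx.
by apply: eq_bigr => i _; rewrite !mxE !enum_valK enum_rankK.
Qed.

Section Vanishing.
Variables (K : fieldType) (V : finType) (sg al be : V -> K).
Notation C := {poly {poly {poly K}}}.
Local Notation line := (line al be).
Local Notation Lx i := (on_x (sg i) (line i)).

(** Dimension count: [(d + 1)^3] monomials against [2 d + 1] conditions per line, since [y] is
    constant on the line and only the degrees in [x] and [w] contribute. *)
Lemma vanishing_poly (S : {set V}) d : (#|S| * (2 * d).+1 < d.+1 ^ 3)%N ->
  exists P : C, [/\ P != 0, tri_deg d d d P & {in S, forall i, Lx i P = 0}].
Proof.
move=> lt.
pose I : finType := ('I_d.+1 * 'I_d.+1 * 'I_d.+1)%type.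
pose J : finType := ('I_#|S| * 'I_(2 * d).+1)%type.
pose mono (t : I) i : {poly K} := 'X^(t.2) * ((sg i)%:P ^+ t.1.2) * line i ^+ t.1.1.
have [|v [[[i0 j0] k0] v0] vE] := @kernel_vector K I J (fun t j => (mono t (enum_val j.1))`_(j.2)).
  by rewrite !card_prod !card_ord; move: lt; rewrite !expnS expn0 muln1 mulnA.
pose P : C := \poly_(i < d.+1) \poly_(j < d.+1) \poly_(k < d.+1) v (inord i, inord j, inord k).
have P0 : P`_i0`_j0`_k0 = v (i0, j0, k0).
  by rewrite coef_poly ltn_ord coef_poly ltn_ord coef_poly ltn_ord !inord_val.
exists P; split.
- by apply: contraNneq v0 => PE; rewrite -P0 PE !coef0.
- split=> [|i|i j]; rewrite ?coef_poly; [exact: size_poly|case: ifP => _|case: ifP => _].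
  + exact: size_poly.
  + by rewrite size_poly0.
  + rewrite coef_poly; case: ifP => _; [exact: size_poly|by rewrite size_poly0].
  + by rewrite coef0 size_poly0.
move=> i iS.
have LE : Lx i P = \sum_t v t *: mono t i.
  transitivity (\sum_a \sum_b \sum_k v (a, b, k) *: mono (a, b, k) i); last first.
    rewrite pair_bigA pair_bigA /=; apply: eq_bigr => -[[a b] k] _ //.
  have -> : Lx i P = P.[(line i)%:P].[(sg i)%:P] by [].
  rewrite horner_poly horner_sum; apply: eq_bigr => a _.
  rewrite hornerM horner_exp hornerC horner_poly mulr_suml; apply: eq_bigr => b _.
  rewrite poly_def !mulr_suml; apply: eq_bigr => k _.
  by rewrite !inord_val /mono /= -!scalerAl.
apply/polyP => l; rewrite coef0.
have [hl|hl] := ltnP l (2 * d).+1; last first.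
  rewrite LE coef_sum big1 // => t _; rewrite coefZ nth_default ?mulr0 //.
  apply: leq_trans hl; rewrite /mono -polyC_exp.
  have h1 := size_line al be i.
  have h2 : (size (line i ^+ t.1.1)%R <= (t.1.1 * 1).+1)%N by apply: size_exp_le.
  have h3 : (size ('X^(t.2) * (sg i ^+ t.1.2)%:P)%R <= (t.2 + 0).+1)%N.
    by apply: size_mul_le; rewrite ?size_polyXn ?size_polyC_leq1.
  apply: leq_trans (size_mul_le h3 h2) _; have := ltn_ord t.2; have := ltn_ord t.1.1.
  by clear; lia.
rewrite LE coef_sum -[RHS](vE (enum_rank_in iS i, Ordinal hl)).
by apply: eq_bigr => t _; rewrite coefZ /= enum_rankK_in.
Qed.

End Vanishing.

(** * Partial degrees and prime components *)

Section Degrees.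
Variable K : fieldType.
Notation C := {poly {poly {poly K}}}.
Implicit Types P Q : C.

Definition degw P := (size P).-1.
Definition degy P := (size (swapXY P)).-1.
Definition degx P := (size (swapXY (map_poly swapXY P))).-1.

Lemma tri_deg_exact P : tri_deg (degw P) (degy P) (degx P) P.
Proof.
split=> [|i|i j]; first exact: leqSpred.
  by apply: leq_trans (leqSpred _); rewrite -sizeYE; apply: max_size_coefXY.
apply: leq_trans (leqSpred _); rewrite -sizeYE.
apply: leq_trans (max_size_coefXY _ i).
by rewrite coef_map /= -sizeYE; apply: max_size_coefXY.
Qed.

Lemma tri_deg_ge a b c P : tri_deg a b c P -> [/\ degw P <= a, degy P <= b & degx P <= c]%N.
Proof.
move=> [Pa Pb Pc]; rewrite /degw /degy /degx -!subn1 !leq_subLR !add1n -!sizeYE.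
split=> //; first by apply/bigmax_leqP.
apply/bigmax_leqP => i _; rewrite coef_map /= -sizeYE; apply/bigmax_leqP => j _.
exact: Pc.
Qed.

Lemma degM P Q : P != 0 -> Q != 0 ->
  [/\ degw (P * Q) = (degw P + degw Q)%N, degy (P * Q) = (degy P + degy Q)%N
    & degx (P * Q) = (degx P + degx Q)%N].
Proof.
have pred_size (R : idomainType) (p q : {poly R}) : p != 0 -> q != 0 ->
    (size (p * q)).-1 = ((size p).-1 + (size q).-1)%N.
  move=> p0 q0; rewrite size_mul //; move: p0 q0; rewrite -!size_poly_gt0.
  by case: (size p) (size q) => [|m] [|n] //; rewrite addnS.
move=> P0 Q0; split; first exact: pred_size.
  by rewrite /degy (rmorphM swapXY) pred_size ?swapXY_eq0.
rewrite /degx (rmorphM (map_poly swapXY)) (rmorphM swapXY) pred_size ?swapXY_eq0 //.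
  by rewrite map_poly_eq0_id0 // swapXY_eq0 lead_coef_eq0.
by rewrite map_poly_eq0_id0 // swapXY_eq0 lead_coef_eq0.
Qed.

(** Partial degrees add over the prime factors. Restriction to a line is a ring morphism into a
    domain, so a line on [P] lies on one of the factors; the unit cannot restrict to zero. *)
Lemma prime_decomposition P d : P != 0 -> tri_deg d d d P ->
  exists l : seq C, [/\ {in l, forall Q, prime_elt Q},
    (\sum_(Q <- l) (degw Q + degy Q) <= 2 * d)%N, {in l, forall Q, degx Q <= d}%N
    & forall s f, on_x s f P = 0 -> exists2 Q, Q \in l & on_x s f Q = 0].
Proof.
move=> P0 Pd.
have ufd : factorial_ring C by do 3![apply: factorial_poly]; apply: factorial_field.
have [u [l [uU lP PE]]] := ufd P P0.
have [dw dy dx] := tri_deg_ge Pd.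
have u0 : u != 0 by apply: contraTneq uU => ->; rewrite unitr0.
have l0 : {in l, forall Q, Q != 0} by move=> Q /lP [].
have pr0 (m : seq C) : {subset m <= l} -> \prod_(Q <- m) Q != 0.
  move=> ml; rewrite prodf_seq_neq0; apply/allP => Q /ml /l0 /= -> //.
have degs (m : seq C) : {subset m <= l} ->
  [/\ degw (\prod_(Q <- m) Q) = (\sum_(Q <- m) degw Q)%N,
      degy (\prod_(Q <- m) Q) = (\sum_(Q <- m) degy Q)%N
    & degx (\prod_(Q <- m) Q) = (\sum_(Q <- m) degx Q)%N].
  elim: m => [|Q m IH] ml.
    have [e1 e2 e3] := @degM 1 1 (oner_neq0 _) (oner_neq0 _).
    rewrite !big_nil; rewrite mulr1 in e1 e2 e3.
    by split; [move: e1|move: e2|move: e3]; clear; lia.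
  have ml' : {subset m <= l} by move=> R Rm; apply: ml; rewrite inE Rm orbT.
  have [e1 e2 e3] := IH ml'.
  have Q0 : Q != 0 by apply: l0; apply: ml; rewrite mem_head.
  have [f1 f2 f3] := degM Q0 (pr0 _ ml').
  by rewrite !big_cons f1 f2 f3 e1 e2 e3.
have [e1 e2 e3] := degs l (fun _ h => h).
have [f1 f2 f3] := degM u0 (pr0 l (fun _ h => h)).
rewrite -PE e1 in f1; rewrite -PE e2 in f2; rewrite -PE e3 in f3.
exists l; split=> //.
- by rewrite big_split /=; move: dw dy; rewrite f1 f2; clear; lia.
- move=> Q Ql; apply: leq_trans dx; rewrite f3 (perm_big _ (perm_to_rem Ql)) big_cons /=.
  by clear; lia.
move=> s f /eqP; rewrite PE (rmorphM (on_x s f : {rmorphism _ -> _})) mulf_eq0.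
case/orP => [/eqP u'0|].
  have := congr1 (on_x s f) (mulrV uU).
  rewrite (rmorphM (on_x s f : {rmorphism _ -> _})) /= u'0 mul0r.
  by rewrite (rmorph1 (on_x s f : {rmorphism _ -> _})) => /esym/eqP; rewrite oner_eq0.
rewrite (rmorph_prod (on_x s f : {rmorphism _ -> _})) prodf_seq_eq0 => /hasP [Q Ql /eqP h].
by exists Q.
Qed.

End Degrees.

(** * Sampling and pruning bipartite graphs *)

(* Derandomized second moment: each [i] is selected with probability [1 / q]; at every step
   one of the two choices does not exceed the conditional expectation. *)
Lemma biased_selection (R : realFieldType) (V T : finType) (w : T -> R) (r : V -> T -> R)
    (q : nat) (L : R) (s : seq V) (u : T -> R) : (0 < q)%N ->
  exists2 s0, subseq s0 s &
    \sum_t w t * (u t + q%:R * (\sum_(i <- s0) r i t) - \sum_(i <- s) r i t) ^+ 2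
      + L * (q%:R * (size s0)%:R - (size s)%:R)
    <= \sum_t w t * u t ^+ 2 + \sum_(i <- s) \sum_t w t * ((q%:R - 1) * r i t ^+ 2).
Proof.
move=> q0; elim: s u => [|x s IH] u.
  exists [::] => //; rewrite !big_nil mulr0 subrr mulr0 !addr0 ler_sum // => t _.
  by rewrite big_nil mulr0 addr0 subr0.
pose X := \sum_t w t * (u t * r x t); pose Y := \sum_t w t * r x t ^+ 2.
(* Relative to the expected value, selecting [x] changes the quantity to be bounded by [(q - 1) Z]
   and rejecting it by [- Z], so the sign of [Z] decides. *)
pose Z := 2 * X + (q%:R - 2) * Y + L.
have F (a : R) : \sum_t w t * (u t + a * r x t) ^+ 2 =
    \sum_t w t * u t ^+ 2 + 2 * a * X + a ^+ 2 * Y.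
  rewrite /X /Y !mulr_sumr -!big_split /=; apply: eq_bigr => t _; ring.
have [Z0|Z0] := lerP Z 0.
  have [s0 sub le] := IH (fun t => u t + (q%:R - 1) * r x t).
  exists (x :: s0); first by rewrite /= eqxx.
  rewrite F in le.
  have E : \sum_t w t * (u t + q%:R * (\sum_(i <- x :: s0) r i t) - \sum_(i <- x :: s) r i t) ^+ 2 =
      \sum_t w t * (u t + (q%:R - 1) * r x t + q%:R * (\sum_(i <- s0) r i t)
        - \sum_(i <- s) r i t) ^+ 2.
    by apply: eq_bigr => t _; rewrite !big_cons; ring.
  have EY : \sum_t w t * ((q%:R - 1) * r x t ^+ 2) = (q%:R - 1) * Y.
    by rewrite mulr_sumr; apply: eq_bigr => t _; ring.
  rewrite E big_cons EY [size (x :: s0)]/= [size (x :: s)]/= -[(size s0).+1]addn1 -[(size s).+1]addn1 !natrD.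
  have q1 : 0 <= q%:R - 1 :> R by rewrite subr_ge0 ler1n.
  have : (q%:R - 1) * Z <= 0 by rewrite mulr_ge0_le0.
  by move: le; rewrite /Z; lra.
have [s0 sub le] := IH (fun t => u t + (- 1) * r x t).
exists s0; first exact: subseq_trans sub (subseq_cons _ _).
rewrite F in le.
have E : \sum_t w t * (u t + q%:R * (\sum_(i <- s0) r i t) - \sum_(i <- x :: s) r i t) ^+ 2 =
    \sum_t w t * (u t + (- 1) * r x t + q%:R * (\sum_(i <- s0) r i t)
      - \sum_(i <- s) r i t) ^+ 2.
  by apply: eq_bigr => t _; rewrite !big_cons; ring.
have EY : \sum_t w t * ((q%:R - 1) * r x t ^+ 2) = (q%:R - 1) * Y.
  by rewrite mulr_sumr; apply: eq_bigr => t _; ring.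
rewrite E big_cons EY [size (x :: s)]/= -[(size s).+1]addn1 natrD.
by move: le Z0; rewrite /Z; lra.
Qed.

Section Bipartite.
Variables (V : finType) (r : rel V).
Implicit Types S T : {set V}.

Definition degl S t := (\sum_(s in S) r s t)%N.
Definition degr T s := (\sum_(t in T) r s t)%N.

Lemma sum_degl S T : (\sum_(t in T) degl S t = \sum_(s in S) degr T s)%N.
Proof. exact: exchange_big. Qed.

(** Take weights [1 / degl S t] and [L = q] in [biased_selection]. A vertex of the last sum receives
    less than half of its expected share, so it adds at least [degl S t / 4] to a weighted variance
    of at most [q (#|S| + #|T|)]. *)
Lemma sampling S T q : (0 < q)%N -> exists S0 : {set V},
  [/\ S0 \subset S, q * #|S0| <= #|S| + #|T| &
   \sum_(t in T | 2 * q * degl S0 t < degl S t) degl S t <= 4 * q * (#|S| + #|T|)]%N.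
Proof.
move=> q0.
pose w t : rat := if t \in T then (degl S t)%:R^-1 else 0.
have w0 t : 0 <= w t by rewrite /w; case: ifP; rewrite // invr_ge0 ler0n.
have [s0 sub le] := biased_selection w (fun s t => (r s t)%:R) q%:R (enum S) (fun=> 0) q0.
have us0 : uniq s0 by apply: subseq_uniq sub (enum_uniq _).
exists [set x in s0].
have sz0 : size s0 = #|[set x in s0]| by rewrite cardsE; apply/esym/card_uniqP.
have szS : size (enum S) = #|S| by rewrite -cardE.
have d0 t : \sum_(i <- s0) (r i t)%:R = (degl [set x in s0] t)%:R :> rat.
  rewrite /degl natr_sum big_uniq //=; apply: eq_bigl => i; by rewrite inE.
have dS t : \sum_(i <- enum S) (r i t)%:R = (degl S t)%:R :> rat.
  by rewrite /degl natr_sum big_enum.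
have LHS : \sum_t w t * (0 + q%:R * (\sum_(i <- s0) (r i t)%:R) - \sum_(i <- enum S) (r i t)%:R) ^+ 2
   = \sum_t w t * (q%:R * (degl [set x in s0] t)%:R - (degl S t)%:R) ^+ 2.
  by apply: eq_bigr => t _; rewrite d0 dS add0r.
have RHS : \sum_t w t * 0 ^+ 2 + \sum_(i <- enum S) \sum_t w t * ((q%:R - 1) * (r i t)%:R ^+ 2)
    <= q%:R * #|T|%:R.
  rewrite big1 => [|t _]; last by rewrite expr0n mulr0.
  rewrite add0r exchange_big /=.
  have -> : #|T|%:R = \sum_t (t \in T)%:R :> rat by rewrite -natr_sum -sum1_card big_mkcond.
  rewrite mulr_sumr; apply: ler_sum => t _.
  have -> : \sum_(i <- enum S) w t * ((q%:R - 1) * (r i t)%:R ^+ 2) = (q%:R - 1) * (w t * (degl S t)%:R).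
    rewrite -dS !mulr_sumr; apply: eq_bigr => i _; case: (r i t); rewrite ?expr1n ?expr0n /=; ring.
  have h : 0 <= w t * (degl S t)%:R <= (t \in T)%:R.
    rewrite /w; case: ifP => _ /=; last by rewrite mul0r lexx.
    have [->|dn0] := eqVneq (degl S t) 0%N; first by rewrite mulr0 lexx ler01.
    by rewrite mulVf ?pnatr_eq0 // ler01 lexx.
  case/andP: h => h1 h2.
  apply: (@le_trans _ _ (q%:R * (w t * (degl S t)%:R))).
    by rewrite ler_wpM2r // gerBl ler01.
  by rewrite ler_wpM2l.
rewrite LHS sz0 szS in le.
have {}le := le_trans le RHS.
set A := \sum_t _ in le.
have A0 : 0 <= A by apply: sumr_ge0 => t _; rewrite mulr_ge0 ?sqr_ge0.
have qpos : 0 < q%:R :> rat by rewrite ltr0n.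
split.
- by apply/subsetP => i; rewrite inE => /(mem_subseq sub); rewrite mem_enum.
- rewrite -(ler_nat rat) natrM natrD -(ler_pM2l qpos).
  by move: le A0; lra.
have bad : (\sum_(t in T | (2 * q * degl [set x in s0] t < degl S t)%N) degl S t)%:R <= 4 * A.
  rewrite natr_sum /A mulr_sumr big_mkcond /=; apply: ler_sum => t _.
  have nn : 0 <= 4 * (w t * (q%:R * (degl [set x in s0] t)%:R - (degl S t)%:R) ^+ 2).
    by rewrite mulr_ge0 // mulr_ge0 ?sqr_ge0.
  case: ifP => // /andP [tT lt]; rewrite /w tT.
  have dpos : 0 < (degl S t)%:R :> rat by rewrite ltr0n; apply: leq_ltn_trans lt.
  rewrite mulrCA mulrC ler_pdivlMr //.
  move: lt; rewrite -(ltr_nat rat) !natrM; move: dpos.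
  have : 0 <= q%:R * (degl [set x in s0] t)%:R :> rat by rewrite mulr_ge0 ?ler0n.
  rewrite -mulrA; move: (q%:R * _) ((degl S t)%:R) => x y; nra.
rewrite -(ler_nat rat) !natrM natrD; apply: le_trans bad _.
rewrite -mulrA ler_pM2l //.
have : 0 <= q%:R * (q%:R * #|[set x in s0]|%:R) :> rat by rewrite !mulr_ge0 ?ler0n.
by move: le; lra.
Qed.

(** Deleting a vertex of degree below [D] loses fewer than [D] edges, so the strict inequality
    persists and keeps the graph from becoming empty. *)
Lemma pruning D S T : (D * (#|S| + #|T|) < \sum_(s in S) degr T s)%N ->
  exists S' T', [/\ S' \subset S, T' \subset T, S' != set0,
    {in S', forall s, D <= degr T' s}%N & {in T', forall t, D <= degl S' t}%N].
Proof.
have [n] := ubnP (#|S| + #|T|); elim: n => // n IH in S T * => /ltnSE le lt.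
have S0 : S != set0 by apply: contraTneq lt => ->; rewrite big_set0.
have [[s [sS lts]]|nos] := EM (exists s, s \in S /\ (degr T s < D)%N).
  have [||S' [T' [h1 h2 h3 h4 h5]]] := IH (S :\ s) T.
  - by move: le; rewrite (cardsD1 s) sS; clear; lia.
  - by move: lt; rewrite (cardsD1 s) sS (big_setD1 s) //=; move: lts; clear; nia.
  by exists S', T'; split=> //; apply: subset_trans h1 (subD1set _ _).
have [[t [tT ltt]]|no] := EM (exists t, t \in T /\ (degl S t < D)%N).
  have [||S' [T' [h1 h2 h3 h4 h5]]] := IH S (T :\ t).
  - by move: le; rewrite (cardsD1 t T) tT; clear; lia.
  - move: lt; rewrite (cardsD1 t T) tT -!sum_degl (big_setD1 t) //=; move: ltt; clear; nia.
  by exists S', T'; split=> //; apply: subset_trans h2 (subD1set _ _).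
exists S, T; split=> // [s sS|t tT]; rewrite leqNgt; apply/negP => h.
  by apply: nos; exists s.
by apply: no; exists t.
Qed.

End Bipartite.

(** * Incidences *)

Lemma card_has_le (V : finType) (Q : Type) (l : seq Q) (A : Q -> {set V}) :
  (#|[set i | has (fun x => i \in A x) l]| <= \sum_(x <- l) #|A x|)%N.
Proof.
elim: l => [|x l IH].
  by rewrite big_nil eq_leq //; apply: eq_card0 => i; rewrite inE.
rewrite big_cons; apply: leq_trans (_ : #|A x :|: [set i | has (fun x => i \in A x) l]| <= _)%N.
  by apply/subset_leq_card/subsetP => i; rewrite !inE.
by apply: leq_trans (leq_add (leqnn _) IH); rewrite cardsU leq_subr.
Qed.

Lemma sum_sqr_le (Q : Type) (l : seq Q) (e : Q -> nat) :
  (\sum_(x <- l) e x ^ 2 <= (\sum_(x <- l) e x) ^ 2)%N.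
Proof.
elim: l => [|x l IH]; first by rewrite !big_nil.
by rewrite !big_cons; move: IH; clear; nia.
Qed.

Section Incidence.
Variables (K : fieldType) (p : nat) (V : finType) (sg al be : V -> K).
Hypothesis pK : p \in [pchar K].
Hypothesis sg_inj : injective sg.
Notation C := {poly {poly {poly K}}}.
Implicit Types (P Q : C) (S T X : {set V}) (h : K * K * K * K).
Local Notation line := (line al be).
Local Notation Lx i := (on_x (sg i) (line i)).
Local Notation Ly i := (on_y (sg i) (line i)).

Definition meets : rel V := fun i j => al i + be i * sg j == al j + be j * sg i.

Lemma meets_sym i j : meets i j = meets j i.
Proof. exact: eq_sym. Qed.

Lemma meets_line i j : meets i j -> (line i).[sg j] = (line j).[sg i].
Proof. by move=> /eqP E; rewrite !hornerE. Qed.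

Lemma meets_eval i j Q : meets i j -> (Lx i Q).[sg j] = (Ly j Q).[sg i].
Proof. by move/meets_line; apply: on_xy. Qed.

(* [h = (c0, c1, c2, c3)] stands for the surface [w = c0 + c1 x + c2 y + c3 x y]. *)
Definition on_bilinear h i :=
  let: (c0, c1, c2, c3) := h in (al i == c0 + c2 * sg i) && (be i == c1 + c3 * sg i).

(** Exchange of [x] and [y]: [on_bilinear (flip h) t] says that the second-kind line of [t] lies on
    the surface [h]. *)
Definition flip h := let: (c0, c1, c2, c3) := h in (c0, c2, c1, c3).

(** For [s] on the surface, meeting [t] is an affine equation in [sg s]; two solutions make it
    vanish identically, which puts the second-kind line of [t] on the surface. *)
Lemma on_bilinear_meet1 h S t : ~~ on_bilinear (flip h) t ->
  (#|[set s in S | on_bilinear h s & meets s t]| <= 1)%N.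
Proof.
case: h => [[[c0 c1] c2] c3] /= nt; apply/card_le1_eqP => i j; rewrite !inE /meets.
case/and3P => _ /andP[/eqP -> /eqP ->] /eqP E1 /and3P [_ /andP[/eqP -> /eqP ->] /eqP E2].
have E : (c2 + c3 * sg t - be t) * (sg i - sg j) = 0.
  move/eqP: E1; rewrite -subr_eq0 => /eqP E1; move/eqP: E2; rewrite -subr_eq0 => /eqP E2.
  by rewrite -[RHS](subrr 0) -{1}E1 -E2; ring.
move/eqP: E; rewrite mulf_eq0 !subr_eq0 => /orP [/eqP bt|/eqP /sg_inj //].
case/negP: nt; rewrite bt eqxx andbT eq_sym; apply/eqP.
move/eqP: E1; rewrite -bt -subr_eq0 => /eqP E1; apply/eqP; rewrite -subr_eq0; apply/eqP.
by rewrite -[RHS]E1; ring.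
Qed.

Lemma on_bilinear_inter h h' T : h != h' ->
  (#|[set t in T | on_bilinear h t & on_bilinear h' t]| <= 1)%N.
Proof.
case: h h' => [[[c0 c1] c2] c3] [[[c0' c1'] c2'] c3'] neq.
apply/card_le1_eqP => i j; rewrite !inE /=.
case/and3P => _ /andP[/eqP -> /eqP ->] /andP[/eqP i1 /eqP i2].
case/and3P => _ /andP[/eqP -> /eqP ->] /andP[/eqP j1 /eqP j2].
apply/eqP/negPn/negP => nij; case/negP: neq.
have key (a b a' b' : K) : a + b * sg i = a' + b' * sg i -> a + b * sg j = a' + b' * sg j ->
    b = b' /\ a = a'.
  move=> e1 e2; have : (b - b') * (sg i - sg j) = 0.
    transitivity ((a + b * sg i) - (a + b * sg j) - (a' + b' * sg i) + (a' + b' * sg j)).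
      ring.
    by rewrite e1 e2; ring.
  move/eqP; rewrite mulf_eq0 !subr_eq0 => /orP [/eqP bb|/eqP /sg_inj ij].
    by split => //; move: e1; rewrite bb => /addIr.
  by rewrite ij eqxx in nij.
have [-> ->] := key _ _ _ _ i1 j1; have [-> ->] := key _ _ _ _ i2 j2.
by rewrite eqxx.
Qed.

(** Each new surface shares at most one line with each of the others, by [on_bilinear_inter]. *)
Lemma sum_on_bilinear (hs : seq (K * K * K * K)) T : uniq hs ->
  (\sum_(h <- hs) #|[set t in T | on_bilinear h t]| <= #|T| + size hs ^ 2)%N.
Proof.
move=> uhs; pose U hs := [set t in T | has (on_bilinear^~ t) hs].
apply: (@leq_trans (#|U hs| + size hs ^ 2)); last first.
  by rewrite leq_add2r subset_leq_card //; apply/subsetP => t; rewrite inE => /andP[].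
elim: hs uhs => [|h hs IH] /=; first by rewrite big_nil.
case/andP => hN uhs; rewrite big_cons.
pose Th := [set t in T | on_bilinear h t].
have UE : U (h :: hs) = Th :|: U hs.
  by apply/setP => t; rewrite !inE /=; case: (t \in T).
have inter : (#|Th :&: U hs| <= size hs)%N.
  have -> : (size hs = \sum_(x <- hs) 1)%N by rewrite sum1_size.
  have := card_has_le hs (fun x => [set t in T | on_bilinear h t & on_bilinear x t]).
  move=> le; apply: leq_trans (leq_trans _ le) _.
    apply/subset_leq_card/subsetP => t; rewrite !inE => /andP[/andP[tT ht] /andP[_ /hasP [x xhs xt]]].
    by apply/hasP; exists x => //; rewrite inE tT ht.
  rewrite !big_seq; apply: leq_sum => x xhs; apply: on_bilinear_inter.
  by apply: contraNneq hN => ->.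
have := cardsUI Th (U hs); rewrite -UE -/Th.
by move: inter (IH uhs); move: #|_ :&: _| #|U (_ :: _)| #|Th| #|U hs| => a b c e; clear; nia.
Qed.

Definition rich S Q :=
  [set i in S | (Lx i Q == 0) && (Lx i (inflection (@deriv_y K) Q) == 0)].

(** A component with many rich lines yields a bilinear surface by [surface_dichotomy]; its degree in
    [w] is positive and pays for this surface in the bound on [size hs]. *)
Lemma bilinear_components (l : seq C) d S :
  {in l, forall Q, prime_elt Q} -> {in l, forall Q, degx Q <= d}%N ->
  {in l, forall Q, degw Q + degy Q <= 2 * d}%N -> ((3 * d).+1 < p)%N -> (3 * d < #|V|)%N ->
  exists hs : seq (K * K * K * K),
    [/\ uniq hs, (size hs <= \sum_(Q <- l) (degw Q + degy Q))%N
      & {in l, forall Q, (exists2 h, h \in hs & forall i, Lx i Q = 0 -> on_bilinear h i) \/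
                   (#|rich S Q| <= 3 * (degw Q + degy Q) ^ 2)%N}].
Proof.
move=> lP lx lwy dp dV.
suff [hs [h1 h2]] : exists hs : seq (K * K * K * K),
    (size hs <= \sum_(Q <- l) (degw Q + degy Q))%N /\
      {in l, forall Q, (exists2 h, h \in hs & forall i, Lx i Q = 0 -> on_bilinear h i) \/
                   (#|rich S Q| <= 3 * (degw Q + degy Q) ^ 2)%N}.
  exists (undup hs); split; [exact: undup_uniq|exact: leq_trans (size_undup _) h1|].
  by move=> Q /h2 [[h hh H]|]; [left; exists h; rewrite ?mem_undup|right].
elim: l lP lx lwy => [|Q l IH] lP lx lwy; first by exists [::]; rewrite big_nil.
have [|||hs [h1 h2]] := IH; try by move=> R Rl; (apply: lP || apply: lx || apply: lwy); rewrite inE Rl orbT.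
have Ql : Q \in Q :: l by rewrite mem_head.
have ext hs' : {subset hs <= hs'} -> {in l, forall Q, (exists2 h, h \in hs' & forall i, Lx i Q = 0 -> on_bilinear h i) \/
                   (#|rich S Q| <= 3 * (degw Q + degy Q) ^ 2)%N}.
  by move=> sub R /h2 [[h hh H]|]; [left; exists h => //; apply: sub|right].
have [small|big] := leqP #|rich S Q| (3 * (degw Q + degy Q) ^ 2).
  exists hs; split; first by rewrite big_cons (leq_trans h1) // leq_addl.
  by move=> R; rewrite inE => /orP [/eqP -> |]; [right|apply: ext].
have [|||szQ [c0 [c1 [c2 [c3 H]]]]] :=
    surface_dichotomy pK sg_inj (al := al) (be := be) (lP _ Ql) (tri_deg_exact Q) _ _ _ big.
- by have := lwy Q Ql; have := lx Q Ql; move: dp; clear; lia.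
- by have := lwy Q Ql; have := lx Q Ql; move: dV; clear; lia.
- by move=> i; rewrite inE => /and3P [_ /eqP -> /eqP ->].
exists ((c0, c1, c2, c3) :: hs); split.
  rewrite big_cons /= -add1n leq_add //; apply: leq_trans (leq_addr _ _).
  by rewrite /degw; case: (size Q) szQ => [|[|]].
move=> R; rewrite inE => /orP [/eqP -> |]; last by apply: ext => h hh; rewrite inE hh orbT.
left; exists (c0, c1, c2, c3); first by rewrite mem_head.
by move=> i /H [e1 e2]; rewrite /on_bilinear e1 e2 !eqxx.
Qed.


Definition crosses Q s t := [&& Lx s Q == 0, Ly t Q != 0 & meets s t].

(** Every [s] counted gives a root [sg s] of the nonzero polynomial [Ly t Q]. *)
Lemma crosses_le S Q t : (\sum_(s in S) crosses Q s t <= degw Q + degy Q)%N.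
Proof.
rewrite /crosses; have [E|nE] := eqVneq (Ly t Q) 0.
  by rewrite big1 // => s; rewrite andbF.
rewrite -ltnS; apply: leq_trans (size_on_y _ (size_line _ _ _) (tri_deg_exact Q)).
apply: (@leq_ltn_trans #|[set s in S | (Lx s Q == 0) && meets s t]|).
  rewrite -sum1_card big_mkcond /= [leqRHS]big_mkcond; apply: leq_sum => s _.
  by rewrite !inE; case: (s \in S) (Lx s Q == 0) (meets s t) => [] [] [].
apply: (max_card_roots sg_inj nE) => s; rewrite inE => /and3P [_ /eqP LQ m].
by rewrite rootE -(meets_eval _ m) LQ horner0.
Qed.

(** Here [1 / q] is the sampling rate and [d] the degree of the interpolating polynomial. The first
    condition on [q] and [d] makes interpolation possible, [96 * d ^ 2 <= #|S|] bounds the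
    inflection lines, and the terms below [D] serve the successive counts. *)
Lemma incidence_core S T k d q D :
  (0 < #|S|)%N -> (#|T| <= #|S|)%N -> (0 < q)%N ->
  (4 * #|S| <= q * d.+1 ^ 2)%N -> (96 * d ^ 2 <= #|S|)%N -> ((3 * d).+1 < p)%N ->
  (forall h, #|[set i in S | on_bilinear h i]| <= k)%N ->
  (128 * q + 4 * q * d + 32 * d + 16 * k < D)%N ->
  {in S, forall s, D <= degr meets T s}%N -> {in T, forall t, D <= degl meets S t}%N -> False.
Proof.
move=> n0 mn q0 dq dn dp hk hD hS hT.
set n := #|S| in n0 mn dq dn; set m := #|T| in mn.
have [S0 [S0S cS0 bad]] := sampling meets S T q0.
(* From [q #|S0| <= 2 n] and [4 n <= q (d + 1)^2] follows [2 #|S0| <= (d + 1)^2]. *)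
have lt : (#|S0| * (2 * d).+1 < d.+1 ^ 3)%N.
  by move: cS0 mn n0 dq; rewrite -/n -/m; move: #|S0|; clear; nia.
have [P [P0 Pd PS0]] := vanishing_poly sg al be lt.
(* A well-sampled [t] meets at least [D / (2 q) > 2 d] sampled lines, more than the degree of [P] on
   its line allows. *)
have PT t : t \in T -> (degl meets S t <= 2 * q * degl meets S0 t)%N -> Ly t P = 0.
  move=> tT good; apply/eqP/negPn/negP => nE.
  have : (#|[set s in S0 | meets s t]| < size (Ly t P))%N.
    apply: (max_card_roots sg_inj nE) => s; rewrite inE => /andP [sS0 ms].
    by rewrite rootE -(meets_eval _ ms) PS0 // horner0.
  move/leq_trans => /(_ _ (size_on_y _ (size_line _ _ _) Pd)).
  have -> : #|[set s in S0 | meets s t]| = degl meets S0 t.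
    rewrite /degl -sum1_card big_mkcond /= [RHS]big_mkcond; apply: eq_bigr => s _.
    by rewrite inE; case: (s \in S0) (meets s t) => [] [].
  by have := hT t tT; move: good hD; clear; nia.
pose S' := [set s in S | Lx s P == 0]; pose T' := [set t in T | Ly t P == 0].
(* A first-kind line off [P] meets at most [2 d] lines of [T'], so at least half of its incidences
   come from badly sampled [t], which carry at most [8 q n] incidences in all. *)
have cnot : (8 * #|S :\: S'| <= n)%N.
  have low s : s \in S :\: S' -> (D <= 2 * degr meets (T :\: T') s)%N.
    rewrite !inE => /andP [h sS]; rewrite sS /= in h.
    have : (#|[set t in T' | meets s t]| < size (Lx s P))%N.
      apply: (max_card_roots sg_inj h) => t; rewrite !inE => /andP [/andP [_ /eqP Lt] ms].
      by rewrite rootE (meets_eval _ ms) Lt horner0.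
    move/leq_trans => /(_ _ (size_on_x _ (size_line _ _ _) Pd)).
    have -> : #|[set t in T' | meets s t]| = degr meets T' s.
      rewrite /degr -sum1_card big_mkcond /= [RHS]big_mkcond; apply: eq_bigr => t _.
      by rewrite inE; case: (t \in T') (meets s t) => [] [].
    have E : degr meets T s = (degr meets T' s + degr meets (T :\: T') s)%N.
      rewrite /degr (big_setID T') /=; congr (_ + _)%N; apply: eq_bigl => t.
      by rewrite !inE; case: (t \in T).
    have := hS s sS; rewrite E; move: (degr meets T' s) (degr _ _ _) hD; clear; lia.
  have h1 : (#|S :\: S'| * D <= 2 * \sum_(s in S :\: S') degr meets (T :\: T') s)%N.
    by rewrite -sum_nat_const big_distrr /=; apply: leq_sum.
  have h2 : (\sum_(s in S :\: S') degr meets (T :\: T') s <= 4 * q * (n + m))%N.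
    apply: leq_trans bad; rewrite -sum_degl.
    apply: (@leq_trans (\sum_(t in T :\: T') degl meets S t)).
      apply: leq_sum => t _; rewrite /degl [leqRHS](big_setID S') /= addnC.
      exact: leq_addr.
    rewrite big_mkcond /= [leqRHS]big_mkcond; apply: leq_sum => t _; rewrite !inE.
    case tT: (t \in T) => //=; rewrite andbT; case: eqP => //= Lt.
    case: ltnP => // good; case: Lt; exact: PT.
  move: h1 h2 hD mn; move: #|_ :\: _| (\sum_(s in _) _)%N; clear -n0; nia.
have [l [lP lwy lx Pl]] := prime_decomposition P0 Pd.
have lwy' : {in l, forall Q, degw Q + degy Q <= 2 * d}%N.
  move=> Q Ql; apply: leq_trans lwy.
  by rewrite (perm_big _ (perm_to_rem Ql)) big_cons /= leq_addr.
have dV : (3 * d < #|V|)%N.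
  apply: leq_trans (max_card (mem S)); rewrite -/n; move: dn n0; clear; nia.
have [hs [uhs szhs Hl]] := bilinear_components S lP lx lwy' dp dV.
(* [S] is covered by [S :\: S'], the lines on bilinear components ([Sa]), the lines of
   inflection points on the other components ([Sb]) and the rest ([Sc]); each of these four
   sets has at most [n / 8] elements. *)
pose small Q := (#|rich S Q| <= 3 * (degw Q + degy Q) ^ 2)%N.
pose Sa := [set s in S | has (on_bilinear^~ s) hs].
pose Sb := [set s | has (fun Q => s \in (if small Q then rich S Q else set0)) l].
pose Sc := [set s in S | [&& s \in S', s \notin Sa & s \notin Sb]].
(* The sum of the bounds is at most [3 (2 d)^2 = 12 d^2], and [96 = 8 * 12]. *)
have cb : (8 * #|Sb| <= n)%N.
  have h1 : (#|Sb| <= \sum_(Q <- l) 3 * (degw Q + degy Q) ^ 2)%N.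
    apply: leq_trans (card_has_le _ _) _; apply: leq_sum => Q _.
    by case: ifP => // _; rewrite cards0.
  rewrite -big_distrr /= in h1.
  have h2 := sum_sqr_le l (fun Q => degw Q + degy Q)%N.
  move: h1 h2 lwy dn; move: #|Sb| (\sum_(Q <- l) _)%N (\sum_(Q <- l) _)%N => x y z.
  clear; nia.
(* Double counting over at most [2 d] surfaces: a [t] on the surface meets at most [k] of its lines,
   any other [t] at most one. *)
have ca : (8 * #|Sa| <= n)%N.
  have h1 : (#|Sa| * D <= \sum_(h <- hs) (k * #|[set t in T | on_bilinear (flip h) t]| + m))%N.
    rewrite -sum_nat_const.
    apply: (@leq_trans (\sum_(s in Sa) degr meets T s)).
      by apply: leq_sum => s; rewrite inE => /andP [sS _]; apply: hS.
    apply: (@leq_trans (\sum_(h <- hs) \sum_(s in S | on_bilinear h s) degr meets T s)).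
      rewrite [leqRHS](exchange_big_dep (fun s => s \in S)) /=; last by move=> h s _ /andP[].
      rewrite big_mkcond [leqRHS]big_mkcond /=; apply: leq_sum => s _.
      rewrite inE; case: (s \in S) => //=; case: hasP => // -[h hh hon].
      by rewrite (perm_big _ (perm_to_rem hh)) big_cons hon /= leq_addr.
    apply: leq_sum => h _; rewrite exchange_big /=.
    have -> : (k * #|[set t in T | on_bilinear (flip h) t]| + m =
       \sum_(t in T) (k * on_bilinear (flip h) t + 1))%N.
      rewrite big_split /= sum1_card -big_distrr /=; congr (_ * _ + _)%N.
      rewrite -sum1_card big_mkcond [RHS]big_mkcond /=; apply: eq_bigr => t _.
      by rewrite inE; case: (t \in T) (on_bilinear _ _) => [] [].
    apply: leq_sum => t _.
    have E : (\sum_(s in S | on_bilinear h s) meets s t)%N = #|[set s in S | on_bilinear h s & meets s t]|.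
      rewrite -sum1_card big_mkcond [RHS]big_mkcond /=; apply: eq_bigr => s _.
      by rewrite inE; case: (s \in S) (on_bilinear _ _) (meets s t) => [] [] [].
    rewrite E; case: (boolP (on_bilinear (flip h) t)) => ht; last first.
      by rewrite muln0 add0n; apply: on_bilinear_meet1.
    rewrite muln1; apply: leq_trans (leq_addr 1 _); apply: leq_trans (hk h).
    by apply/subset_leq_card/subsetP => s; rewrite !inE => /and3P [-> ->].
  have h2 : (\sum_(h <- hs) #|[set t in T | on_bilinear (flip h) t]| <= m + size hs ^ 2)%N.
    have fK : injective flip by move=> [[[a b] c] e] [[[a' b'] c'] e'] [] -> -> -> ->.
    have := @sum_on_bilinear (map flip hs) T; rewrite map_inj_uniq // => /(_ uhs).
    by rewrite big_map size_map.
  have h3 : (\sum_(h <- hs) m = size hs * m)%N.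
    by rewrite big_const_seq count_predT iter_addn_0 mulnC.
  rewrite big_split /= -big_distrr /= h3 in h1.
  have h4 := leq_trans szhs lwy.
  have D0 : (0 < D)%N by move: hD; clear; lia.
  rewrite -(leq_pmul2r D0).
  move: h1 h2 h4 dn hD mn n0; rewrite -/n -/m.
  move: #|Sa| (size hs) (\sum_(h <- hs) _)%N => x y z h1 h2 h4 dn hD mn n0.
  have y2 : (y ^ 2 <= n)%N by move: h4 dn; clear; nia.
  have kz : (k * z <= 2 * (k * n))%N by move: h2 y2 mn; clear; nia.
  have ym : (y * m <= 2 * (d * n))%N by move: h4 mn; clear; nia.
  have : (n * (16 * k + 32 * d) <= n * D)%N by rewrite leq_mul2l; apply/orP; right; move: hD; clear; lia.
  by move: h1 kz ym; clear; nia.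
(* The inflection polynomial has degree at most [9 * d] on [Lx s] and vanishes where [Lx s] meets a
   second-kind line on [Q]. The remaining incidences are crossings, at most [2 d] for each [t]. *)
have cc : (8 * #|Sc| <= n)%N.
  pose G s := (\sum_(Q <- l) \sum_(t in T) crosses Q s t)%N.
  have h1 s : s \in Sc -> (D <= 9 * d + G s)%N.
    rewrite !inE => /and4P [sS /andP [_ /eqP LP] nSa nSb].
    have [Q Ql LQ] := Pl _ _ LP.
    have sm : small Q.
      case: (Hl Q Ql) => // -[h hh H]; case/negP: nSa; rewrite sS /=.
      by apply/hasP; exists h => //; apply: H.
    have nE : Lx s (inflection (@deriv_y K) Q) != 0.
      apply: contra nSb => LE; apply/hasP; exists Q => //=.
      by rewrite sm inE sS LQ eqxx.
    have c1 : (#|[set t in T | (Ly t Q == 0%R) && meets s t]| <= 9 * d)%N.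
      have Hd := tri_deg_inflection (@tri_deg_derivy K _ _ _) (tri_deg_exact Q).
      have le2 := size_on_x (sg s) (size_line al be s) Hd.
      have : (#|[set t in T | (Ly t Q == 0%R) && meets s t]| < size (Lx s (inflection (@deriv_y K) Q)))%N.
        apply: (max_card_roots sg_inj nE) => t; rewrite inE => /and3P [_ /eqP Lt ms].
        by rewrite rootE (meets_eval _ ms) (on_y_inflection (line_deriv2 al be t) Lt) horner0.
      move=> /leq_trans /(_ le2); rewrite ltnS => /leq_trans; apply.
      by move: (lwy' Q Ql) (lx Q Ql); clear; lia.
    have c2 : (\sum_(t in T) crosses Q s t <= G s)%N.
      by rewrite /G (perm_big _ (perm_to_rem Ql)) big_cons /= leq_addr.
    apply: leq_trans (hS s sS) _; apply: leq_trans (leq_add c1 c2).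
    rewrite -sum1_card big_mkcond /degr [X in (_ <= _ + X)%N]big_mkcond /=.
    rewrite [X in (X <= _)%N]big_mkcond -big_split /=; apply: leq_sum => t _.
    rewrite !inE /crosses LQ eqxx /=.
    by case: (t \in T) (Ly t Q == 0) (meets s t) => [] [] [].
  have h2 : (\sum_(s in Sc) G s <= 2 * (d * m))%N.
    apply: (@leq_trans (\sum_(s in S) G s)).
      rewrite big_mkcond [leqRHS]big_mkcond /=; apply: leq_sum => s _.
      by rewrite inE; case: (s \in S) => //=; case: ifP.
    rewrite /G exchange_big /=.
    apply: (@leq_trans (\sum_(Q <- l) \sum_(t in T) (degw Q + degy Q))).
      apply: leq_sum => Q _; rewrite exchange_big /=; apply: leq_sum => t _.
      exact: crosses_le.
    rewrite (eq_bigr (fun Q => (degw Q + degy Q) * m)%N); last first.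
      by move=> Q _; rewrite sum_nat_const mulnC.
    by rewrite -big_distrl /= mulnA leq_mul2r lwy orbT.
  have h3 : (#|Sc| * D <= #|Sc| * (9 * d) + 2 * (d * m))%N.
    apply: leq_trans (leq_add (leqnn _) h2).
    by rewrite -!sum_nat_const -big_split /=; apply: leq_sum.
  move: h3 hD mn n0; rewrite -/n -/m; move: #|Sc| => x h3 hD mn n0.
  have h4 : (x * (23 * d).+1 <= 2 * (d * n))%N.
    have : (x * (9 * d + (23 * d).+1) <= x * D)%N by rewrite leq_mul2l; apply/orP; right; move: hD; clear; lia.
    have : (d * m <= d * n)%N by rewrite leq_mul2l mn orbT.
    by move: h3; clear; nia.
  by move: h4; clear; nia.
have : (n <= #|S :\: S'| + #|Sa| + #|Sb| + #|Sc|)%N.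
  apply: (@leq_trans #|(S :\: S') :|: Sa :|: Sb :|: Sc|).
    apply/subset_leq_card/subsetP => s sS; rewrite [s \in _]inE [s \in _ :|: _]inE.
    rewrite [s \in _ :|: Sa]inE [s \in Sc]inE sS /= [s \in S :\: S']inE sS andbT.
    by case: (s \in S') (s \in Sa) (s \in Sb) => [] [] [].
  have U (A B : {set V}) : (#|A :|: B| <= #|A| + #|B|)%N by rewrite cardsU leq_subr.
  apply: leq_trans (U _ _) _; rewrite leq_add2r.
  by apply: leq_trans (U _ _) _; rewrite leq_add2r.
move: cnot ca cb cc n0; clear; lia.
Qed.

End Incidence.

(* [D0] stands for the maximum of [sqrt #|X|] and of the number of collinear points. *)
Theorem incidence_bound (k0 : nat) : exists C0 : nat,
  forall (K : fieldType) (p : nat) (V : finType) (sg al be : V -> K) (X : {set V}) (D0 : nat),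
  p \in [pchar K] -> injective sg ->
  (forall h, #|[set i in X | on_bilinear sg al be h i]| <= D0)%N ->
  (#|X| <= D0 ^ 2)%N -> (#|X| <= k0 * p ^ 2)%N ->
  (\sum_(s in X) degr (meets sg al be) X s <= C0 * D0 * #|X|)%N.
Proof.
(* For the least admissible [d], [384 = 4 * 96] gives [96 d^2 <= n] and [144 = 4 * 36] gives
   [6 d <= p]. The value of [c] adds up the terms required below [D], with [d <= D0] and
   [1 <= D0]. *)
pose q := (384 + 144 * k0)%N; pose c := (132 * q + 49)%N.
exists (2 * c)%N => K p V sg al be X D0 pK inj hk XD Xp.
rewrite leqNgt; apply/negP => big.
set r := meets sg al be in big *.
have rsym s t : r s t = r t s by apply: meets_sym.
have [|S [T [SX TX S0 hS hT]]] := @pruning _ r (c * D0) X X.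
  by move: big; move: (\sum_(s in X) _)%N => z; clear; nia.
have main (S1 T1 : {set V}) : S1 \subset X -> T1 \subset X -> (0 < #|S1|)%N -> (#|T1| <= #|S1|)%N ->
    {in S1, forall s, c * D0 <= degr r T1 s}%N -> {in T1, forall t, c * D0 <= degl r S1 t}%N -> False.
  move=> S1X T1X n0 mn hS1 hT1.
  have nX : (#|S1| <= #|X|)%N by apply: subset_leq_card.
  have ex : exists d, (4 * #|S1| <= q * d.+1 ^ 2)%N.
    by exists (4 * #|S1|)%N; rewrite /q; clear; nia.
  have [d dq dmin] := ex_minnP ex.
  have p1 : (1 < p)%N by apply: prime_gt1; apply: pcharf_prime pK.
  have dlt : (d = 0 \/ q * d ^ 2 < 4 * #|S1|)%N.
    case: d dmin {dq} => [|d] dmin; [by left|right].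
    by rewrite ltnNge; apply/negP => /dmin; rewrite ltnn.
  have dn : (96 * d ^ 2 <= #|S1|)%N.
    by case: dlt => [->|]; rewrite // /q; clear; nia.
  have dp : ((3 * d).+1 < p)%N.
    case: dlt => [->|lt]; first by rewrite muln0.
    have : (36 * d ^ 2 <= p ^ 2)%N.
      have := leq_trans nX Xp; move: lt; rewrite /q; clear -dn n0.
      case: k0 => [|k1]; nia.
    by clear -p1; case: d => [|d]; [rewrite muln0|]; nia.
  have hk1 h : (#|[set i in S1 | on_bilinear sg al be h i]| <= D0)%N.
    apply: leq_trans (hk h); apply/subset_leq_card/subsetP => i; rewrite !inE.
    by case/andP => /(subsetP S1X) -> ->.
  have hD : (128 * q + 4 * q * d + 32 * d + 16 * D0 < c * D0)%N.
    have dD : (d <= D0)%N.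
      have := leq_trans nX XD; move: dn; clear; nia.
    have D1 : (0 < D0)%N by move: (leq_trans nX XD) n0; clear; nia.
    rewrite /c; move: dD D1; clear; nia.
  exact: (incidence_core pK inj n0 mn _ dq dn dp hk1 hD hS1 hT1).
(* The relation is symmetric, so the larger side can play the role of [S]. *)
have [le|lt] := leqP #|T| #|S|; first by apply: (main S T) => //; rewrite card_gt0.
apply: (main T S) => //; [exact: leq_ltn_trans lt|exact: ltnW| |].
  move=> t /hT; rewrite /degl /degr => /leq_trans; apply; apply: eq_leq.
  by apply: eq_bigr => s _; rewrite rsym.
move=> t /hS; rewrite /degl /degr => /leq_trans; apply; apply: eq_leq.
by apply: eq_bigr => s _; rewrite rsym.
Qed.

(** * A generic symplectic transformation *)

Lemma meets_frac (K : fieldType) (V : finType) (s a b w : V -> K) i j :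
  w i != 0 -> w j != 0 ->
  meets (fun i => s i / w i) (fun i => a i / w i) (fun i => b i / w i) i j =
  (a i * w j + b i * s j == a j * w i + b j * s i).
Proof.
move=> wi wj; rewrite /meets.
have E (x y z u v : K) : u != 0 -> v != 0 -> x / u + y / u * (z / v) = (x * v + y * z) / (u * v).
  by move=> u0 v0; field; rewrite u0 v0.
rewrite !E // [w j * _]mulrC (can_eq (mulfVK _)) //.
by rewrite mulf_neq0.
Qed.

(** The two equations describe a projective line, on which some coordinate is injective: [b] if
    [c3 != 0]. If [c3 = 0], then [b] is constant, and [a] serves when [c2 != 0], [s] when
    [c2 = 0]. *)
Lemma collinear_coordinate (K : fieldType) (c0 c1 c2 c3 T : K) :
  let P a b s := a = c0 * (1 + b * T ^+ 2) + c2 * (s + b * T + a * T ^+ 2) /\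
                 b = c1 * (1 + b * T ^+ 2) + c3 * (s + b * T + a * T ^+ 2) in
  [\/ forall a b s a' b' s', P a b s -> P a' b' s' -> a = a' -> b = b' /\ s = s',
      forall a b s a' b' s', P a b s -> P a' b' s' -> b = b' -> a = a' /\ s = s'
    | forall a b s a' b' s', P a b s -> P a' b' s' -> s = s' -> a = a' /\ b = b'].
Proof.
move=> P; have cancel (x y z : K) : x != 0 -> x * (y - z) = 0 -> y = z.
  by move=> x0 /eqP; rewrite mulf_eq0 (negPf x0) subr_eq0 => /eqP.
have diff (x y z w : K) : x = z -> y = w -> x - y - (z - w) = 0 by move=> -> ->; rewrite subrr.
have [c30|c3n] := eqVneq c3 0; last first.
  apply: Or32 => a b s a' b' s' [e1 e2] [e1' e2'] bb; subst b'.
  have ss : s + b * T + a * T ^+ 2 = s' + b * T + a' * T ^+ 2.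
    apply: (cancel c3) => //; rewrite -(diff _ _ _ _ e2' e2); ring.
  have aa : a = a' by rewrite e1 e1' ss.
  by split=> //; move: ss; rewrite aa => /addIr /addIr.
subst c3.
have bb a b s a' b' s' : P a b s -> P a' b' s' -> b = b'.
  move=> [_ e] [_ e']; rewrite !mul0r !addr0 in e e'.
  have h (x : K) : x = c1 * (1 + x * T ^+ 2) -> (1 - c1 * T ^+ 2) * x = c1.
    move=> xE; apply/eqP; rewrite -subr_eq0; apply/eqP.
    by rewrite -[RHS](subrr x) {3}xE; ring.
  have [z|nz] := eqVneq (1 - c1 * T ^+ 2) 0.
    have := h _ e; rewrite z mul0r => c10; move: z; rewrite -c10 mul0r subr0 => /eqP.
    by rewrite oner_eq0.
  by apply: (mulfI nz); rewrite (h _ e) (h _ e').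
have [c20|c2n] := eqVneq c2 0.
  apply: Or33 => a b s a' b' s' h h' _; have E := bb _ _ _ _ _ _ h h'; split=> //.
  by case: h h' => [-> _] [-> _]; rewrite E c20 !mul0r.
apply: Or31 => a b s a' b' s' h h' aa; have E := bb _ _ _ _ _ _ h h'; split=> //.
subst a' b'; case: h h' => [e _] [e' _].
have ss : s + b * T + a * T ^+ 2 = s' + b * T + a * T ^+ 2.
  apply: (cancel c2) => //; rewrite -(diff _ _ _ _ e' e); ring.
by move: ss => /addIr /addIr.
Qed.

Section Generic.
Variable F : finFieldType.
Notation K := {fraction {poly F}}.
Local Notation V := (F * F * F)%type.
Implicit Types t : V.

Definition den t : {poly F} := 1 + t.1.2 *: 'X^2.
Definition num t : {poly F} := t.2%:P + t.1.2 *: 'X + t.1.1 *: 'X^2.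

Lemma den_neq0 t : tofrac (den t) != 0.
Proof.
rewrite tofrac_eq0; apply/eqP => /(congr1 (fun P : {poly F} => P`_0)) /eqP.
by rewrite coefD coefZ coefXn coef1 coef0 mulr0 addr0 oner_eq0.
Qed.

(* A generic symplectic transformation of projective space, so that distinct points get
   distinct last coordinates. *)
Definition gen_a t : K := tofrac (t.1.1)%:P / tofrac (den t).
Definition gen_b t : K := tofrac (t.1.2)%:P / tofrac (den t).
Definition gen_s t : K := tofrac (num t) / tofrac (den t).

(** After cross-multiplication the coefficients of [1], [X] and [X^2] return [s], [b] and then
    [a]. *)
Lemma gen_s_inj : injective gen_s.
Proof.
move=> [[a b] s] [[a' b'] s'] /eqP.
rewrite /gen_s eqr_div ?den_neq0 // -!rmorphM /= tofrac_eq => /eqP.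
rewrite /num /den /=.
have E x y z w : (z%:P + y *: 'X + x *: 'X^2) * (1 + w *: 'X^2) =
   z%:P + y *: 'X + (x + z * w) *: 'X^2 + (y * w) *: 'X^3 + (x * w) *: 'X^4 :> {poly F}.
  by rewrite -!mul_polyC !polyCD !polyCM; ring.
rewrite !E => PE.
have c0 := congr1 (fun P : {poly F} => P`_0) PE.
have c1 := congr1 (fun P : {poly F} => P`_1) PE.
have c2 := congr1 (fun P : {poly F} => P`_2) PE.
rewrite /= !(coefD, coefZ, coefC, coefX, coefXn) /= !(mulr0, mulr1, addr0, add0r) in c0 c1 c2.
by move: c2; rewrite c0 c1 => /addIr ->.
Qed.

(** Once denominators are cleared, the transformation has added the same expression, symmetric in
    [t] and [t'], to both sides. *)
Lemma gen_meets t t' : meets gen_s gen_a gen_b t t' =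
  (t.1.1 + t.1.2 * t'.2 == t'.1.1 + t'.1.2 * t.2).
Proof.
have d0 := den_neq0 t; have d0' := den_neq0 t'.
have := @meets_frac K V (fun t => tofrac (num t)) (fun t => tofrac (t.1.1)%:P)
  (fun t => tofrac (t.1.2)%:P) (fun t => tofrac (den t)) t t' d0 d0'.
rewrite -[LHS]/(meets gen_s gen_a gen_b t t') => ->.
rewrite -!rmorphM -!rmorphD /= tofrac_eq /den /num.
case: t t' {d0 d0'} => [[a b] s] [[a' b'] s'] /=.
rewrite -[in RHS](inj_eq (@polyC_inj F)) !polyCD !polyCM -!mul_polyC.
rewrite -subr_eq0 -[in RHS]subr_eq0; congr (_ == _); ring.
Qed.

(** One of the original coordinates is injective on the set by [collinear_coordinate], and it takes
    at most [n] values. *)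
Lemma gen_collinear (A B S : {set F}) h n :
  (#|A| <= n)%N -> (#|B| <= n)%N -> (#|S| <= n)%N ->
  (#|[set t in [set t : V | [&& t.1.1 \in A, t.1.2 \in B & t.2 \in S]]
      | on_bilinear gen_s gen_a gen_b h t]| <= n)%N.
Proof.
move=> An Bn Sn; set Y := [set t in _ | _].
have byinj (f : V -> F) (U : {set F}) : (#|U| <= n)%N -> {in Y, forall t, f t \in U} ->
    {in Y &, injective f} -> (#|Y| <= n)%N.
  move=> Un fU inj; rewrite -(card_in_imset inj); apply: leq_trans Un.
  by apply/subset_leq_card/subsetP => x /imsetP [t tY ->]; apply: fU.
have YA : {in Y, forall t, t.1.1 \in A} by move=> t; rewrite !inE => /andP[/and3P[]].
have YB : {in Y, forall t, t.1.2 \in B} by move=> t; rewrite !inE => /andP[/and3P[]].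
have YS : {in Y, forall t, t.2 \in S} by move=> t; rewrite !inE => /andP[/and3P[]].
pose io (x : F) : K := tofrac x%:P.
have io_inj x y : io x = io y -> x = y.
  by move/eqP; rewrite tofrac_eq => /eqP/polyC_inj.
pose T : K := tofrac 'X.
case: h @Y byinj YA YB YS => [[[c0 c1] c2] c3] Y byinj YA YB YS.
have eqs t : t \in Y ->
   io t.1.1 = c0 * (1 + io t.1.2 * T ^+ 2) + c2 * (io t.2 + io t.1.2 * T + io t.1.1 * T ^+ 2) /\
   io t.1.2 = c1 * (1 + io t.1.2 * T ^+ 2) + c3 * (io t.2 + io t.1.2 * T + io t.1.1 * T ^+ 2).
  rewrite !inE /on_bilinear => /andP [_ /andP [/eqP e1 /eqP e2]].
  have dE : 1 + io t.1.2 * T ^+ 2 = tofrac (den t).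
    by rewrite /den -mul_polyC tofracD tofracM tofrac1 tofracXn.
  have nE : io t.2 + io t.1.2 * T + io t.1.1 * T ^+ 2 = tofrac (num t).
    by rewrite /num -!mul_polyC 2!tofracD 2!tofracM tofracXn.
  rewrite dE nE; have d0 := den_neq0 t; split; apply: (mulIf (invr_neq0 d0)).
    by rewrite [LHS]e1 /gen_s mulrDl mulfK // mulrA.
  by rewrite [LHS]e2 /gen_s mulrDl mulfK // mulrA.
case: (collinear_coordinate c0 c1 c2 c3 T) => inj.
- apply: (byinj (fun t => t.1.1) A) => // t t' /eqs e /eqs e' aa.
  have [/io_inj bb /io_inj ss] := inj _ _ _ _ _ _ e e' (congr1 io aa).
  by case: t t' aa bb ss {e e'} => [[? ?] ?] [[? ?] ?] /= -> -> ->.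
- apply: (byinj (fun t => t.1.2) B) => // t t' /eqs e /eqs e' bb.
  have [/io_inj aa /io_inj ss] := inj _ _ _ _ _ _ e e' (congr1 io bb).
  by case: t t' aa bb ss {e e'} => [[? ?] ?] [[? ?] ?] /= -> -> ->.
apply: (byinj (fun t => t.2) S) => // t t' /eqs e /eqs e' ss.
have [/io_inj aa /io_inj bb] := inj _ _ _ _ _ _ e e' (congr1 io ss).
by case: t t' aa bb ss {e e'} => [[? ?] ?] [[? ?] ?] /= -> -> ->.
Qed.

End Generic.

(** * Energy *)

Definition triples (F : finFieldType) (A B S : {set F}) : {set F * F * F} :=
  [set t | [&& t.1.1 \in A, t.1.2 \in B & t.2 \in S]].

Lemma card_triples (F : finFieldType) (A B S : {set F}) :
  #|triples A B S| = (#|A| * #|B| * #|S|)%N.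
Proof.
rewrite -!cardsX; apply: eq_card => -[[a b] s]; by rewrite !inE /= andbA.
Qed.

Definition solutions (F : finFieldType) (X : {set F * F * F}) :
    {set (F * F * F) * (F * F * F)} :=
  [set z | [&& z.1 \in X, z.2 \in X &
     z.1.1.1 + z.1.1.2 * z.2.2 == z.2.1.1 + z.2.1.2 * z.1.2]].

Lemma card_solutions_le (k0 : nat) : exists C0 : nat,
  forall (F : finFieldType) (p : nat) (A B S : {set F}) (D0 : nat),
  p \in [pchar F] -> (#|A| <= D0)%N -> (#|B| <= D0)%N -> (#|S| <= D0)%N ->
  (#|A| * #|B| * #|S| <= D0 ^ 2)%N -> (#|A| * #|B| * #|S| <= k0 * p ^ 2)%N ->
  (#|solutions (triples A B S)| <= C0 * D0 * (#|A| * #|B| * #|S|))%N.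
Proof.
have [C0 H] := incidence_bound k0; exists C0 => F p A B S D0 pF An Bn Sn ND Np.
rewrite -card_triples in ND Np *.
have pK : p \in [pchar {fraction {poly F}}].
  apply: (rmorph_pchar (@tofrac {poly F})); by rewrite pchar_poly.
have col h := gen_collinear h An Bn Sn.
apply: leq_trans (H _ p _ _ _ _ _ _ pK (@gen_s_inj F) col ND Np).
rewrite -sum1_card (eq_bigl (fun z => [&& z.1 \in triples A B S, z.2 \in triples A B S &
     z.1.1.1 + z.1.1.2 * z.2.2 == z.2.1.1 + z.2.1.2 * z.1.2])); last first.
  by move=> z; rewrite inE.
rewrite -(pair_big_dep (mem (triples A B S)) (fun t t' => (t' \in triples A B S) &&
   (t.1.1 + t.1.2 * t'.2 == t'.1.1 + t'.1.2 * t.2)) (fun _ _ => 1%N)) /=.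
apply: leq_sum => t _; rewrite /degr big_mkcond [leqRHS]big_mkcond /=.
apply: leq_sum => t' _; rewrite gen_meets; by case: (t' \in _) (_ == _) => [] [].
Qed.

Section Energy.
Variable F : finFieldType.
Implicit Types A B C : {set F}.

(** The assignment [phi] is injective: the inverses return [b1] and [b2], and then the products can
    be divided by them. *)
Lemma energy_le_solutions A B C :
  (additive_energy A C * #|B :\ 0%R| ^ 2 <=
   #|solutions (triples A [set x^-1 | x in B :\ 0%R] (prodset B C))|)%N.
Proof.
rewrite /additive_energy; set E := [set t | _].
rewrite -mulnn -!cardsX.
pose phi (z : (F * F * F * F) * (F * F)) : (F * F * F) * (F * F * F) :=
  let: ((x1, x2, y1, y2), (b1, b2)) := z in ((x1, b1^-1, b2 * y2), (x2, b2^-1, b1 * y1)).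
rewrite -(@card_in_imset _ _ phi).
  apply/subset_leq_card/subsetP => w /imsetP [[[[[x1 x2] y1] y2] [b1 b2]]].
  rewrite !inE /= => /andP [/and5P [x1A x2A y1C y2C /eqP e] /andP[/andP[b10 b1B] /andP[b20 b2B]]] ->.
  rewrite /= x1A x2A !imset_f ?inE ?b10 ?b20 //= !imset2_f //=.
  by rewrite !mulKf // e.
move=> [[[[x1 x2] y1] y2] [b1 b2]] [[[[x1' x2'] y1'] y2'] [b1' b2']].
rewrite !inE /= => /andP [_ /andP[/andP[b10 b1B] /andP[b20 b2B]]] _.
case=> -> /invr_inj bb1 e2 -> /invr_inj bb2 e1; rewrite -bb1 -bb2 in e1 e2 *.
by rewrite (mulfI b10 e1) (mulfI b20 e2).
Qed.

Lemma card_invset B : #|[set x^-1 | x in B]| = #|B|.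
Proof. exact/card_imset/invr_inj. Qed.

Lemma card_prodset_ge A B b : b \in B -> b != 0 -> (#|A| <= #|prodset A B|)%N.
Proof.
move=> bB b0; rewrite -(card_imset A (mulIf b0)); apply/subset_leq_card/subsetP => x.
by case/imsetP => a aA ->; apply: imset2_f.
Qed.

(** Cauchy-Schwarz over the fibres of [f]. *)
Lemma sum_sqr_card (T I : finType) (X : {set T}) (f : T -> I) :
  (#|X| ^ 2 <= #|f @: X| * #|[set z : T * T | [&& z.1 \in X, z.2 \in X & f z.1 == f z.2]]|)%N.
Proof.
pose n v := #|[set x in X | f x == v]|.
have E1 : (#|X| = \sum_(v in f @: X) n v)%N.
  rewrite -sum1_card (partition_big f (mem (f @: X))) /=; last by move=> x; apply: imset_f.
  by apply: eq_bigr => v _; rewrite /n -sum1_card; apply: eq_bigl => x; rewrite !inE.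
have E2 : (#|[set z : T * T | [&& z.1 \in X, z.2 \in X & f z.1 == f z.2]]| = \sum_(v in f @: X) n v ^ 2)%N.
  rewrite -sum1_card (partition_big (fun z => f z.1) (mem (f @: X))) /=; last first.
    by move=> z; rewrite inE => /and3P [zX _ _]; apply: imset_f.
  apply: eq_bigr => v _; rewrite /n -mulnn -cardsX -sum1_card; apply: eq_bigl => -[x y].
  rewrite !inE /=; case: (x \in X); case: (y \in X); rewrite ?andbF //=.
  by apply/andP/andP => -[/eqP -> /eqP ->].
rewrite E1 E2 -mulnn big_distrlr /= -(leq_pmul2l (ltn0Sn 1)).
apply: (@leq_trans (\sum_(v in f @: X) \sum_(u in f @: X) (n v ^ 2 + n u ^ 2))).
  rewrite big_distrr /=; apply: leq_sum => v _; rewrite big_distrr /=.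
  by apply: leq_sum => u _; apply: nat_Cauchy.
under eq_bigr do rewrite big_split sum_nat_const.
rewrite big_split /= sum_nat_const -big_distrr /=; by clear; lia.
Qed.

Lemma energy_sumset A : (#|A| ^ 4 <= additive_energy A A * #|sumset A A|)%N.
Proof.
have := @sum_sqr_card _ _ (setX A A) (fun z => z.1 + z.2).
rewrite cardsX mulnn -expnM mulnC => /leq_trans; apply.
have -> : [set z.1 + z.2 | z in setX A A] = sumset A A.
  apply/setP => x; apply/imsetP/imset2P => [[[a b]]|[a b aA bA ->]].
    by rewrite inE => /andP [aA bA] ->; exists a b.
  by exists (a, b); rewrite ?inE ?aA.
rewrite leq_mul2r; apply/orP; right; rewrite /additive_energy.
pose phi (z : (F * F) * (F * F)) := (z.1.1, z.2.1, z.1.2, z.2.2).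
rewrite -(@card_in_imset _ _ phi); last by move=> [[a b] [c d]] [[a' b'] [c' d']] _ _ [-> -> -> ->].
apply/subset_leq_card/subsetP => w /imsetP [[[a b] [c d]]]; rewrite !inE /=.
by case/and3P => /andP [aA bA] /andP [cA dA] /eqP e ->; rewrite /= aA bA cA dA e eqxx.
Qed.

Lemma energy_diffset A : (#|A| ^ 4 <= additive_energy A A * #|diffset A A|)%N.
Proof.
have := @sum_sqr_card _ _ (setX A A) (fun z => z.1 - z.2).
rewrite cardsX mulnn -expnM mulnC => /leq_trans; apply.
have -> : [set z.1 - z.2 | z in setX A A] = diffset A A.
  apply/setP => x; apply/imsetP/imset2P => [[[a b]]|[a b aA bA ->]].
    by rewrite inE => /andP [aA bA] ->; exists a b.
  by exists (a, b); rewrite ?inE ?aA.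
rewrite leq_mul2r; apply/orP; right; rewrite /additive_energy.
(* The equation [a - b = c - d] becomes [a + d = c + b]. *)
pose phi (z : (F * F) * (F * F)) := (z.1.1, z.2.1, z.2.2, z.1.2).
rewrite -(@card_in_imset _ _ phi); last by move=> [[a b] [c d]] [[a' b'] [c' d']] _ _ [-> -> -> ->].
apply/subset_leq_card/subsetP => w /imsetP [[[a b] [c d]]]; rewrite !inE /=.
case/and3P => /andP [aA bA] /andP [cA dA] /eqP e ->; rewrite /= aA bA cA dA /=.
by rewrite -(subrK b a) e addrAC subrK.
Qed.

End Energy.

(** * Energy bound and sum-product estimates *)

Lemma energy_bound (k0 : nat) : exists C0 : nat,
  forall (F : finFieldType) (p : nat) (A B C : {set F}) (D0 : nat),
  p \in [pchar F] -> (#|A| <= D0)%N -> (#|B :\ 0%R| <= D0)%N -> (#|prodset B C| <= D0)%N ->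
  (#|A| * #|B :\ 0%R| * #|prodset B C| <= D0 ^ 2)%N ->
  (#|A| * #|B :\ 0%R| * #|prodset B C| <= k0 * p ^ 2)%N ->
  (additive_energy A C * #|B :\ 0%R| <= C0 * D0 * (#|A| * #|prodset B C|))%N.
Proof.
have [C0 H] := card_solutions_le k0; exists C0 => F p A B C D0 pF An Bn Sn ND Np.
have := H F p A [set x^-1 | x in B :\ 0%R] (prodset B C) D0 pF An.
rewrite card_invset => /(_ Bn Sn ND Np) h.
have {h} := leq_trans (energy_le_solutions A B C) h.
set b := #|B :\ 0%R|; case: (posnP b) => [b0|b0]; first by move=> _; rewrite b0 muln0.
move=> h; rewrite -(leq_pmul2r b0) -mulnA mulnn; apply: leq_trans h _.
by apply: eq_leq; ring.
Qed.

(** Here [L] stands for the larger of the two set sizes, and [B] for [A] or the inverses of its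
    nonzero elements. Unless [L^5 >= n^6] already, the energy bound with [D] about [n sqrt L] gives
    [n^4 << n L^(5/2)]. *)
Lemma sum_product : exists2 c1 : nat, (0 < c1)%N &
  forall (F : finFieldType) (p : nat) (A B : {set F}) (L : nat),
  p \in [pchar F] -> (#|A| ^ 8 < p ^ 5)%N -> (1 < #|A|)%N ->
  (#|A| <= 2 * #|B :\ 0%R|)%N -> (#|B| <= #|A|)%N ->
  (#|A| ^ 4 <= additive_energy A A * L)%N -> (#|prodset B A| <= L)%N ->
  (#|A| ^ 6 <= c1 * L ^ 5)%N.
Proof.
have [C0 H] := energy_bound 1; exists (64 * C0 ^ 2).+1 => // F p A B L pF np n1 nB Bn CS PL.
set n := #|A| in np n1 nB Bn CS *; set b := #|B :\ 0%R| in nB; set bc := #|prodset B A| in PL.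
have [a aA a0] : exists2 a, a \in A & a != 0.
  apply: contrapT => no; move: n1; rewrite ltnNge; apply/negP/negPn.
  rewrite -(cards1 (0 : F)); apply/subset_leq_card/subsetP => x xA; rewrite inE.
  by apply/negPn/negP => x0; apply: no; exists x.
have Bbc : (#|B| <= bc)%N by apply: card_prodset_ge aA a0.
have b0 : (0 < b)%N by move: nB n1; clear; lia.
have [b' b'B] : exists b', b' \in B :\ 0%R by apply/card_gt0P.
have nbc : (n <= bc)%N.
  move: b'B; rewrite !inE => /andP [b'0 b'B].
  rewrite /n -(card_imset _ (mulfI b'0)); apply/subset_leq_card/subsetP => x.
  by case/imsetP => y yA ->; apply: imset2_f.
have bn : (b <= n)%N by apply: leq_trans Bn; apply/subset_leq_card/subD1set.
have [big|small] := leqP (n ^ 6) (L ^ 5).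
  apply: leq_trans big _; exact: leq_pmull.
have Ln : (L <= n ^ 2)%N.
  rewrite -(leq_exp2r _ _ (isT : 0 < 5)%N) -expnM.
  apply: leq_trans (ltnW small) _; rewrite leq_exp2l //.
have nL : (n <= L)%N := leq_trans nbc PL.
have n0 : (0 < n)%N := ltnW n1.
have ex : exists D, (n ^ 2 * L <= D ^ 2)%N.
  exists (n * L)%N; rewrite expnMn leq_mul // -mulnn leq_pmull //.
  exact: leq_trans nL.
have [D DL Dmin] := ex_minnP ex.
have D0 : (0 < D)%N.
  rewrite lt0n; apply: contraTneq DL => ->.
  by rewrite -ltnNge exp0n // muln_gt0 expn_gt0 n0 (leq_trans n0 nL).
have DD : (D ^ 2 <= 4 * (n ^ 2 * L))%N.
  have lt : ((D.-1) ^ 2 < n ^ 2 * L)%N.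
    by rewrite ltnNge; apply/negP => /Dmin; rewrite leqNgt prednK ?leqnn.
  have [D1|D1] := leqP D 1.
    apply: (@leq_trans 1%N); first by move: D1; case: (D) => [|[|]].
    by rewrite !muln_gt0 ?expn_gt0 n0 (leq_trans n0 nL).
  have h : (D <= 2 * D.-1)%N by move: D1; case: (D) => [|[|k]] //=; clear; lia.
  apply: leq_trans (_ : (2 * D.-1) ^ 2 <= _)%N; first by rewrite leq_exp2r.
  by rewrite expnMn leq_mul2l /= ltnW.
have LD : (L <= D)%N.
  rewrite -(leq_exp2r _ _ (isT : 0 < 2)%N); apply: leq_trans DL.
  by rewrite -mulnn leq_mul2r Ln orbT.
have nbcL : (n * b * bc <= n ^ 2 * L)%N by rewrite -mulnn leq_mul // leq_mul2l bn orbT.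
(* As [L^5 < n^6], the fifth power of the left-hand side is at most [n^16], which is below [p^10];
   the exponent [5 / 8] comes from here. *)
have np2 : (n ^ 2 * L <= 1 * p ^ 2)%N.
  rewrite mul1n -(leq_exp2r _ _ (isT : 0 < 5)%N) expnMn -!expnM.
  apply: (@leq_trans (n ^ 16)).
    by rewrite (_ : 16 = 2 * 5 + 6)%N // expnD leq_mul // ltnW.
  by rewrite (_ : 16 = 8 * 2)%N // [(2 * 5)%N]mulnC !expnM leq_exp2r // ltnW.
have := H F p A B A D pF (leq_trans nL LD) (leq_trans bn (leq_trans nL LD)) (leq_trans PL LD)
  (leq_trans nbcL DL) (leq_trans nbcL np2).
rewrite -/b -/bc -/n => HE.
move: (additive_energy A A) CS HE => E CS HE.
have h1 : (E <= 2 * C0 * D * L)%N.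
  have : (E * n <= 2 * (C0 * D * (n * L)))%N.
    apply: (@leq_trans (2 * (E * b))%N).
      by rewrite mulnCA leq_mul2l nB orbT.
    rewrite leq_mul2l /=; apply: leq_trans HE _.
    by rewrite !leq_mul2l PL !orbT.
  by move=> h; rewrite -(leq_pmul2r n0); apply: leq_trans h _; apply: eq_leq; ring.
have h2 : (n ^ 4 <= 2 * C0 * D * L ^ 2)%N.
  apply: leq_trans CS _; apply: (@leq_trans (2 * C0 * D * L * L)); first by rewrite leq_mul2r h1 orbT.
  by rewrite -mulnn mulnA.
have h3 : (n ^ 8 <= 4 * C0 ^ 2 * D ^ 2 * L ^ 4)%N.
  have := leq_mul h2 h2; rewrite -expnD => /leq_trans; apply.
  by apply: eq_leq; ring.
have h4 : (n ^ 8 <= n ^ 2 * (16 * C0 ^ 2 * L ^ 5))%N.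
  apply: leq_trans h3 _; apply: (@leq_trans (4 * C0 ^ 2 * (4 * (n ^ 2 * L)) * L ^ 4)).
    by rewrite leq_mul2r leq_mul2l DD !orbT.
  by apply: eq_leq; ring.
have n20 : (0 < n ^ 2)%N by rewrite expn_gt0 n0.
rewrite -(leq_pmul2l n20) -expnD; apply: leq_trans h4 _.
rewrite leq_mul2l leq_mul2r; apply/orP; right; apply/orP; right.
by clear; lia.
Qed.

Section SmallDoubling.
Variables (F : finFieldType).
Implicit Types A : {set F}.

Lemma card_le_units A : (0 < #|A :\ 0%R|)%N -> (#|A| <= 2 * #|A :\ 0%R|)%N.
Proof. by rewrite (cardsD1 0%R A); case: (_ \in A); move: #|_ :\ _| => n; lia. Qed.

Lemma card_units_gt0 A : (1 < #|A|)%N -> (0 < #|A :\ 0%R|)%N.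
Proof. by rewrite (cardsD1 0%R A); case: (_ \in A); move: #|_ :\ _| => n; lia. Qed.

Lemma card_inv_units A : #|[set x^-1 | x in A :\ 0%R] :\ 0%R| = #|A :\ 0%R|.
Proof.
rewrite -(card_invset (A :\ 0%R)); apply: eq_card => x; rewrite in_setD1 andb_idl //.
by case/imsetP => y; rewrite !inE => /andP [y0 _] ->; rewrite invr_eq0.
Qed.

Lemma prodset_inv_sub_ratioset A : prodset [set x^-1 | x in A :\ 0%R] A \subset ratioset A.
Proof.
apply/subsetP => z /imset2P [_ x /imsetP [y yA ->] xA ->].
move: yA; rewrite !inE => /andP [y0 yA].
by apply/imset2P; exists x y; rewrite ?inE ?yA ?y0 // mulrC.
Qed.

End SmallDoubling.

Lemma sum_product_sets : exists2 c1 : nat, (0 < c1)%N &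
  forall (F : finFieldType) (p : nat) (A : {set F}),
  p \in [pchar F] -> (#|A| ^ 8 < p ^ 5)%N ->
  [/\ #|A| ^ 6 <= c1 * maxn #|sumset A A| #|prodset A A| ^ 5,
      #|A| ^ 6 <= c1 * maxn #|diffset A A| #|prodset A A| ^ 5,
      #|A| ^ 6 <= c1 * maxn #|sumset A A| #|ratioset A| ^ 5
    & #|A| ^ 6 <= c1 * maxn #|diffset A A| #|ratioset A| ^ 5]%N.
Proof.
have [c1 c10 H] := sum_product; exists c1 => // F p A pF np.
(* The ratio set enters as a superset of the product of [A] with the inverses of its nonzero
   elements. Sets with at most one element are checked directly. *)
have main (D PR : {set F}) : (#|A| ^ 4 <= additive_energy A A * #|D|)%N ->
    (#|prodset A A| <= #|PR|)%N || (#|prodset [set x^-1 | x in A :\ 0%R] A| <= #|PR|)%N ->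
    (#|A| ^ 6 <= c1 * maxn #|D| #|PR| ^ 5)%N.
  move=> CS hPR; have [n1|n1] := ltnP 1 #|A|.
    have CS' : (#|A| ^ 4 <= additive_energy A A * maxn #|D| #|PR|)%N.
      by apply: leq_trans CS _; rewrite leq_mul2l leq_maxl orbT.
    case/orP: hPR => hPR.
      apply: (H F p A A) => //; first exact/card_le_units/card_units_gt0.
      by apply: leq_trans hPR _; rewrite leq_maxr.
    apply: (H F p A [set x^-1 | x in A :\ 0%R]) => //.
    - by rewrite card_inv_units; apply/card_le_units/card_units_gt0.
    - by rewrite card_invset subset_leq_card // subD1set.
    - by apply: leq_trans hPR _; rewrite leq_maxr.
  have [->|A0] := posnP #|A|; first by rewrite exp0n.
  have A1 : #|A| = 1%N by apply/eqP; rewrite eqn_leq n1 A0.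
  rewrite A1 exp1n muln_gt0 c10 expn_gt0 leq_max.
  by move: CS; rewrite A1 exp1n muln_gt0 => /andP [_ ->].
have p1 : (#|prodset A A| <= #|prodset A A|)%N || (#|prodset [set x^-1 | x in A :\ 0%R] A| <= #|prodset A A|)%N.
  by rewrite leqnn.
have p2 : (#|prodset A A| <= #|ratioset A|)%N || (#|prodset [set x^-1 | x in A :\ 0%R] A| <= #|ratioset A|)%N.
  by rewrite (subset_leq_card (prodset_inv_sub_ratioset A)) orbT.
by split; apply: main => //; (apply: energy_sumset || apply: energy_diffset).
Qed.

(** * Passage to real exponents *)

Section Powers.
Variable R : realType.

Lemma powR_three_halves (x b : R) : 0 <= x -> 0 < b ->
  x `^ (3 / 2) * b `^ (- (1 / 2)) = Num.sqrt (x * b) * x / b.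
Proof.
move=> x0 b0; rewrite powRN mul1r (powR12_sqrt (ltW b0)).
have -> : (3 / 2 : R) = 2^-1 * 3%:R by rewrite mulrC.
rewrite powRrM (powR12_sqrt x0) powR_mulrn ?sqrtr_ge0 // sqrtrM //.
have s0 : Num.sqrt b != 0 by rewrite gt_eqF // sqrtr_gt0.
have E (u v : R) : v != 0 -> u ^+ 3 / v = u * v * u ^+ 2 / v ^+ 2 by move=> v0; field.
by rewrite (E _ _ s0) !sqr_sqrtr // ltW.
Qed.

Lemma powR_six_fifths (c1 n L : nat) : (0 < c1)%N -> (n ^ 6 <= c1 * L ^ 5)%N ->
  (c1%:R `^ (1 / 5))^-1 * n%:R `^ (1 + 1 / 5) <= L%:R :> R.
Proof.
move=> c10 le; have c1p : 0 < (c1%:R : R) `^ (1 / 5) by rewrite powR_gt0 // ltr0n.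
rewrite mulrC ler_pdivrMr // [leRHS]mulrC.
have -> : (1 + 1 / 5 : R) = 6%:R * (1 / 5) by field.
have -> : (L%:R : R) = (L%:R ^+ 5) `^ (1 / 5).
  rewrite -powR_mulrn ?ler0n // -powRrM.
  have -> : (5%:R * (1 / 5) : R) = 1 by field.
  by rewrite powRr1 ?ler0n.
rewrite powRrM powR_mulrn ?ler0n // -powRM ?ler0n ?exprn_ge0 //.
apply: ge0_ler_powR; rewrite ?nnegrE ?mulr_ge0 ?exprn_ge0 ?ler0n ?invr_ge0 ?ler0n //.
by rewrite -!natrX -natrM ler_nat.
Qed.

Lemma lt_powR_five_eighths (n p : nat) : n%:R < p%:R `^ (5 / 8) :> R -> (n ^ 8 < p ^ 5)%N.
Proof.
move=> lt; rewrite -(ltr_nat R) !natrX.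
have -> : p%:R ^+ 5 = (p%:R `^ (5 / 8)) ^+ 8 :> R.
  rewrite -[RHS]powR_mulrn ?powR_ge0 // -powRrM.
  have -> : (5 / 8 * 8%:R : R) = 5%:R by field.
  by rewrite powR_mulrn ?ler0n.
by rewrite ltrXn2r ?powR_ge0 ?ler0n.
Qed.

End Powers.

(** [K] depends on the constant [k] implied in [<< p^2]. The excluded sets are cases where the
    inequality can fail: the right-hand side is 0 for empty [B]; for [B = {0}] and [A = C = F] the
    energy is [#|F|^3] against order [#|F|^2]; for [C = {0}] and a singleton [A] the energy is 1,
    while the right-hand side tends to 0 as [B] grows. *)
Theorem theorem6 (R : realType) :
  (forall k : R, 0 < k -> exists2 K : R, 0 < K &
     forall (F : finFieldType) (p : nat), p \in [pchar F] -> odd p ->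
     forall A B C : {set F}, B != set0 -> B != [set 0] -> C != [set 0] ->
     let a : R := #|A|%:R in
     let b : R := #|B|%:R in
     let bc : R := #|prodset B C|%:R in
     let M : R := Num.max a bc in
     a * b * bc <= k * p%:R ^+ 2 ->
     (additive_energy A C)%:R <=
       K * ((a * bc) `^ (3 / 2) * b `^ (- (1 / 2)) + M * a * bc * b^-1))
  /\
  (exists2 c : R, 0 < c &
     forall (F : finFieldType) (p : nat), p \in [pchar F] -> odd p ->
     forall A : {set F}, #|A|%:R < p%:R `^ (5 / 8) :> R ->
     let lower : R := c * #|A|%:R `^ (1 + 1 / 5) in
     [/\ lower <= (maxn #|sumset A A| #|prodset A A|)%:R,
         lower <= (maxn #|diffset A A| #|prodset A A|)%:R,
         lower <= (maxn #|sumset A A| #|ratioset A|)%:R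
       & lower <= (maxn #|diffset A A| #|ratioset A|)%:R]).
Proof.
split; last first.
  have [c1 c10 H] := sum_product_sets.
  exists (c1%:R `^ (1 / 5))^-1; first by rewrite invr_gt0 powR_gt0 // ltr0n.
  move=> F p pF _ A /lt_powR_five_eighths np lower.
  by have [h1 h2 h3 h4] := H F p A pF np; split; apply: powR_six_fifths.
move=> k k0; have [C0 H] := energy_bound (Num.truncn k).+1.
exists (4 * C0%:R + 1); first by rewrite ltr_wpDl // mulr_ge0 ?ler0n.
move=> F p pF _ A B C Bn0 Bn1 Cn1 a b bc M hyp.
have M0 : 0 <= M by rewrite le_max ler0n.
have b0 : 0 < b by rewrite ltr0n card_gt0.
have RHS0 : 0 <= (4 * C0%:R + 1) * ((a * bc) `^ (3 / 2) * b `^ (- (1 / 2)) + M * a * bc * b^-1).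
  apply: mulr_ge0; first by rewrite addr_ge0 ?mulr_ge0 ?ler0n.
  by apply: addr_ge0; rewrite !mulr_ge0 ?powR_ge0 ?invr_ge0 ?ler0n.
have [E0|E0] := posnP (additive_energy A C); first by rewrite E0.
have [[[[x1 x2] y1] y2]] : exists t, t \in [set t : F * F * F * F | let: (x1, x2, y1, y2) := t in
      [&& x1 \in A, x2 \in A, y1 \in C, y2 \in C & x1 + y1 == x2 + y2]] by apply/card_gt0P.
rewrite inE => /and5P [x1A _ y1C _ _].
have nz (X : {set F}) x : x \in X -> X != [set 0] -> exists2 y, y \in X & y != 0.
  move=> xX; apply: contra_neqP => no; apply/setP => y; rewrite inE.
  have only0 z : z \in X -> z = 0.
    by move=> zX; apply/eqP/negPn/negP => z0; apply: no; exists z.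
  by apply/idP/eqP => [/only0 //|->]; rewrite -(only0 _ xX).
have [c cC c0] := nz C y1 y1C Cn1.
have [x xB] : exists x, x \in B by apply/set0Pn.
have [b' b'B b'0] := nz B x xB Bn1.
set b1 := #|B :\ 0%R|.
have b1p : (0 < b1)%N by apply/card_gt0P; exists b'; rewrite !inE b'0.
have bb1 : (#|B| <= 2 * b1)%N by apply: card_le_units.
have b1b : (b1 <= #|B|)%N by apply/subset_leq_card/subD1set.
have Bbc : (#|B| <= #|prodset B C|)%N by apply: card_prodset_ge cC c0.
set N := (#|A| * b1 * #|prodset B C|)%N.
have NE : N%:R <= a * bc * b.
  by rewrite mulrAC -!natrM ler_nat /N !leq_mul.
have sN := truncnS_gt (Num.sqrt (N%:R : R)).
set s := Num.truncn _ in sN.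
have sle : s%:R <= Num.sqrt (a * bc * b).
  apply: (@le_trans _ _ (Num.sqrt N%:R)); last by rewrite ler_wsqrtr.
  by rewrite truncn_le sqrtr_ge0.
(* [D0] must dominate both [m] and the square root of [N]; the 1 lost in rounding is absorbed by
   [M >= 1]. *)
pose m := maxn #|A| #|prodset B C|; pose D0 := (m + s)%N.+1.
have mE : M = m%:R.
  by rewrite /M /m /maxn /Num.max /Order.max ltr_nat; case: ifP.
have m1 : (0 < m)%N by rewrite /m leq_max (leq_trans (leq_trans b1p b1b) Bbc) orbT.
have ND : (N <= D0 ^ 2)%N.
  rewrite -(ler_nat R) natrX -[leLHS]sqr_sqrtr ?ler0n // ler_sqr ?nnegrE ?sqrtr_ge0 ?ler0n //.
  by apply: le_trans (ltW sN) _; rewrite ler_nat ltnS leq_addl.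
have Np : (N <= (Num.truncn k).+1 * p ^ 2)%N.
  rewrite -(ler_nat R) natrM natrX; apply: le_trans NE _; rewrite mulrAC.
  apply: le_trans hyp _; rewrite ler_wpM2r ?exprn_ge0 ?ler0n //.
  exact/ltW/truncnS_gt.
have mD : (m <= D0)%N by rewrite /D0 -addnS leq_addr.
have := H F p A B C D0 pF (leq_trans (leq_maxl _ _) mD)
  (leq_trans (leq_trans b1b Bbc) (leq_trans (leq_maxr _ _) mD)) (leq_trans (leq_maxr _ _) mD) ND Np.
rewrite -/b1 => h.
have {}h : (additive_energy A C)%:R * b <= 2 * (C0%:R * D0%:R * (a * bc)).
  rewrite -!natrM ler_nat; apply: (@leq_trans (2 * (additive_energy A C * b1))).
    by rewrite mulnCA leq_mul2l bb1 orbT.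
  by rewrite leq_mul2l h.
have D0E : D0%:R <= 2 * M + Num.sqrt (a * bc * b).
  rewrite /D0 -addn1 !natrD -mE mulr2n mulrDl mul1r.
  have : 1 <= M by rewrite mE ler1n.
  by move: sle; lra.
rewrite powR_three_halves ?mulr_ge0 ?ler0n //.
move: sle; set q := Num.sqrt _ => _.
have q0 : 0 <= q by apply: sqrtr_ge0.
have x0 : 0 <= a * bc by rewrite mulr_ge0 ?ler0n.
have -> : q * (a * bc) / b + M * a * bc * b^-1 = (q + M) * (a * bc) / b.
  by rewrite -mulrA -!mulrA -mulrDl !mulrA.
rewrite mulrA ler_pdivlMr //; apply: le_trans h _.
rewrite mulrA [X in _ <= X]mulrA ler_wpM2r //.
have C00 : 0 <= C0%:R :> R by apply: ler0n.
have : C0%:R * D0%:R <= C0%:R * (2 * M + q) by rewrite ler_wpM2l.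
have : 0 <= C0%:R * q by rewrite mulr_ge0.
by move: M0 q0; nra.
Qed.
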